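(* For $i=1,2$, let $G_i$ be a 4-regular graph gadget with signature $(\alpha_i,\beta_i,\gamma_i)\in S$, where $\alpha_1\alpha_2\neq1$. Let $G_3$ be the 2-glue of $G_1$ and $G_2$, with signature $(\alpha_3,\beta_3,\gamma_3)$ given by $$\alpha_3=\frac{\alpha_1\beta_2+\alpha_1\gamma_2+\beta_1\alpha_2+\gamma_1\alpha_2}{1-\alpha_1\alpha_2},\quad \beta_3=\frac{\beta_1\gamma_2+\gamma_1\beta_2}{1-\alpha_1\alpha_2},\quad \gamma_3=\frac{\beta_1\beta_2+\gamma_1\gamma_2}{1-\alpha_1\alpha_2}.$$ Then $(\alpha_3,\beta_3,\gamma_3)\in S$.
   Context: The set $S\subseteq\mathbb{R}^3$ consists of all vectors $P(\alpha,\beta,\gamma)^{\mathrm T}$, where $P$ is a $3\times3$ permutation matrix, $\alpha\ge\beta\ge\gamma\ge0$, $\alpha+\beta+\gamma=1$, and $\gamma\ge f(\beta)$, where $f(x)=\frac12(1-x)\bigl(1-\exp(2x/(x-1))\bigr)$. A 4-regular graph gadget is a finite undirected graph (parallel edges and loops allowed) together with exactly four half-edges, labelled $0,1,2,3$, each incident with exactly one vertex, such that every vertex has degree 4 (counting half-edges, and loops twice). A route is a trail (no repeated edges, repeated vertices allowed) starting with one half-edge and ending with another. A valid set of routes is a set of two routes such that every edge and every half-edge is travelled exactly once (routes are considered up to reversal); equivalently, it is a choice at every vertex of a perfect matching of the four edge-ends/half-edges at it such that following the matchings yields two trails joining the four half-edges in pairs and no closed trails. $\mathrm{VR}(\{a,b\},\{c,d\})$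 denotes the set of valid sets of routes in which one route connects half-edges $a,b$ and the other connects $c,d$. The signature of a gadget is the triple $(\alpha,\beta,\gamma)$ with $\alpha=|\mathrm{VR}(\{0,1\},\{2,3\})|/N$, $\beta=|\mathrm{VR}(\{0,2\},\{1,3\})|/N$, $\gamma=|\mathrm{VR}(\{0,3\},\{1,2\})|/N$, where $N$ is the sum of the three cardinalities (defined when $N>0$). The 2-glue of gadgets $G_1,G_2$ is the gadget obtained from their disjoint union by connecting half-edge $3$ of $G_1$ with half-edge $0$ of $G_2$ and half-edge $2$ of $G_1$ with half-edge $1$ of $G_2$ (each connected pair becomes one edge); its half-edges $0,1$ are half-edges $0,1$ of $G_1$ and its half-edges $2,3$ are half-edges $2,3$ of $G_2$. *)

(* Defs.v *)
From HB Require Import structures.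
From mathcomp Require Import all_boot all_order all_fingroup all_algebra.
From mathcomp Require Import reals sequences exp.
Set Implicit Arguments.
Unset Strict Implicit.
Unset Printing Implicit Defensive.
Import Order.TTheory GRing.Theory Num.Theory.
Local Open Scope ring_scope.

(* The two ends of an edge e are (e, false) and (e, true); the orientation
   this gives to e plays no role.  A half-edge has a single end attached to a
   vertex. *)
Definition edge_end (E : finType) : finType := ((E * bool) + 'I_4)%type.

(* Vertices carry exactly four ends, so a loop, both of whose ends are attached
   to the same vertex, counts twice; parallel edges are distinct elements of
   [edge]. *)
Record gadget := Gadget {
  vertex : finType;
  edge : finType;
  att : edge_end edge -> vertex;
  att_deg4 : forall v : vertex, #|[set d | att d == v]| = 4
}.

Definition he0 : 'I_4 := @Ordinal 4 0 isT.
Definition he1 : 'I_4 := @Ordinal 4 1 isT.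
Definition he2 : 'I_4 := @Ordinal 4 2 isT.
Definition he3 : 'I_4 := @Ordinal 4 3 isT.

Section Routes.
Variable G : gadget.
Implicit Types (m : {ffun edge_end (edge G) -> edge_end (edge G)}).

(* A choice, at every vertex, of a perfect matching of the ends at this vertex,
   encoded as a fixed-point-free involution preserving the attachment vertex.
   The two directions of traversing a loop give different matchings. *)
Definition matching_system m : bool :=
  [forall d, [&& m d != d, m (m d) == d & att (m d) == att d]].

(* The other end of the same edge; the outer end of a half-edge is free. *)
Definition opposite (d : edge_end (edge G)) : edge_end (edge G) :=
  match d with
  | inl (e, b) => inl (e, ~~ b)
  | inr i => inr i
  end.

Definition follow m : rel (edge_end (edge G)) :=
  fun x y => (y == m x) || (y == opposite x).

Definition same_trail m : rel (edge_end (edge G)) := connect (follow m).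

(* Every component of [follow m] is either an open trail joining two
   half-edges or a closed trail, which meets no half-edge. *)
Definition no_closed_trail m : bool :=
  [forall d, [exists i : 'I_4, same_trail m d (inr i)]].

Definition valid_routes m : bool := matching_system m && no_closed_trail m.

Definition VR (a b c d : 'I_4) :
    {set {ffun edge_end (edge G) -> edge_end (edge G)}} :=
  [set m | [&& valid_routes m, same_trail m (inr a) (inr b)
                             & same_trail m (inr c) (inr d)]].

Definition VR_alpha := VR he0 he1 he2 he3.
Definition VR_beta := VR he0 he2 he1 he3.
Definition VR_gamma := VR he0 he3 he1 he2.

Definition VR_total : nat := (#|VR_alpha| + #|VR_beta| + #|VR_gamma|)%N.

End Routes.

Definition has_signature (R : realType) (G : gadget) (a b c : R) : Prop :=
  [/\ (0 < VR_total G)%N,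
      a = #|VR_alpha G|%:R / (VR_total G)%:R,
      b = #|VR_beta G|%:R / (VR_total G)%:R
    & c = #|VR_gamma G|%:R / (VR_total G)%:R].

Section Glue.
Variables G1 G2 : gadget.

(* Besides the edges of [G1] and [G2], there is one new edge [inr true] made of
   half-edge 3 of [G1] and half-edge 0 of [G2], and one new edge [inr false]
   made of half-edge 2 of [G1] and half-edge 1 of [G2]. *)
Definition glue_edge : finType := ((edge G1 + edge G2) + bool)%type.

Definition glue_end (d : edge_end glue_edge) :
    edge_end (edge G1) + edge_end (edge G2) :=
  match d with
  | inl (inl (inl e), b) => inl (inl (e, b))
  | inl (inl (inr e), b) => inr (inl (e, b))
  | inl (inr true, false) => inl (inr he3)
  | inl (inr true, true) => inr (inr he0)
  | inl (inr false, false) => inl (inr he2)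
  | inl (inr false, true) => inr (inr he1)
  | inr i => if (i < 2)%N then inl (inr i) else inr (inr i)
  end.

Definition glue_att (d : edge_end glue_edge) : (vertex G1 + vertex G2)%type :=
  match glue_end d with
  | inl x => inl (att x)
  | inr y => inr (att y)
  end.

Lemma glue_end_inj : injective glue_end.
Proof.
move=> [[[[e|e]|[]] []]|[[|[|[|[|i]]]] Hi]] //
       [[[[e'|e']|[]] []]|[[|[|[|[|j]]]] Hj]] // => H;
  by [inversion H | congr inr; apply: val_inj].
Qed.

Lemma glue_end_bij : bijective glue_end.
Proof.
apply: (inj_card_bij glue_end_inj).
rewrite !card_sum !card_prod !card_sum !card_ord card_bool.
by rewrite !mulnDl -!addnA leq_add2l addnCA.
Qed.

Lemma glue_deg4 (v : (vertex G1 + vertex G2)%type) :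
  #|[set d | glue_att d == v]| = 4.
Proof.
have [h hK Kh] := glue_end_bij.
case: v => v; rewrite -(att_deg4 v).
- have -> : [set d | glue_att d == inl v] =
            [set h (inl x) | x in [set x | att x == v]].
    apply/setP=> d; rewrite inE; apply/idP/imsetP => [|[x]].
      rewrite /glue_att; case E: (glue_end d) => [x|y] // /eqP[Hx].
      by exists x; rewrite ?inE ?Hx // -E hK.
    by rewrite inE => /eqP <- ->; rewrite /glue_att Kh.
  by rewrite card_imset // => x y /(congr1 glue_end); rewrite !Kh => -[].
- have -> : [set d | glue_att d == inr v] =
            [set h (inr x) | x in [set x | att x == v]].
    apply/setP=> d; rewrite inE; apply/idP/imsetP => [|[x]].
      rewrite /glue_att; case E: (glue_end d) => [x|y] // /eqP[Hx].
      by exists y; rewrite ?inE ?Hx // -E hK.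
    by rewrite inE => /eqP <- ->; rewrite /glue_att Kh.
  by rewrite card_imset // => x y /(congr1 glue_end); rewrite !Kh => -[].
Qed.

Definition glue2 : gadget := Gadget glue_deg4.

End Glue.

Section TheSetS.
Variable R : realType.

Definition vec3 (a b c : R) : 'cV[R]_3 := \col_(i < 3) [:: a; b; c]`_i.

Definition f_bound (x : R) : R :=
  2^-1 * (1 - x) * (1 - expR (2 * x / (x - 1))).

Definition in_S (v : 'cV[R]_3) : Prop :=
  exists (P : 'M[R]_3) (a b c : R),
    [/\ is_perm_mx P, v = P *m vec3 a b c,
        a >= b /\ b >= c /\ c >= 0,
        a + b + c = 1 & c >= f_bound b].

End TheSetS.

(* Main.v *)
(** Let [u = a / (b + c)] and [t = |b - c| / (b + c)].  Under the 2-glue, [u] is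
    additive and [t] is multiplicative.  Membership in S amounts to an upper and
    a lower bound on [t] in terms of [u], and both are preserved because the
    slope [- ln t / u] is monotone along the two bounding curves: the upper curve
    gives a subadditive function [- ln t] of [u], the lower curve a superadditive
    one.  Parametrising both curves by [z], with [expR (- z)] the quotient that
    occurs in the definition of S, makes the slopes explicit.

    That the signature of the glue is the stated one follows from the fact that
    every trail contains at most two half-edges: the trail of a half-edge is an
    orbit of the composition of the matching with the exchange of the two ends
    of an edge, and this exchange acts on the cyclic orbit as a reflection. *)

Require Import Defs.
From HB Require Import structures.
From mathcomp Require Import all_boot all_order all_fingroup all_algebra.
From mathcomp Require Import reals sequences exp.
From mathcomp Require Import zify ring lra.
Set Implicit Arguments.
Unset Strict Implicit.
Unset Printing Implicit Defensive.
Import Order.TTheory GRing.Theory Num.Theory.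

(** * Trails and half-edges *)

Section Involution_pair.
Variables (T : finType) (s t : T -> T).
Hypotheses (sK : involutive s) (tK : involutive t) (s_fix : forall x, s x != x).

(** In the application [s] is a matching and [t] is [opposite], so that [step] is [follow] and the
    fixed points of [t] are the half-edges. *)
Let step : rel T := fun x y => (y == s x) || (y == t x).
Let pi x := t (s x).

Let pi_inj : injective pi.
Proof. exact: inj_comp (inv_inj tK) (inv_inj sK). Qed.

Let iter_pi_inj k : injective (iter k pi).
Proof. by elim: k => //= k IHk x y /pi_inj/IHk. Qed.

Lemma step_connect_sym : connect_sym step.
Proof.
apply: sym_connect_sym => x y; rewrite /step.
by congr (_ || _); apply/eqP/eqP => ->; rewrite ?sK ?tK.
Qed.

Section From_end.
Variable x : T.
Hypothesis tx : t x = x.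

(* [t] conjugates [pi] into its inverse. *)
Let iter_pi_t i : iter i pi (t (iter i pi x)) = x.
Proof. by elim: i => [|i IHi]; rewrite ?tx// iterSr /= /pi tK sK. Qed.

(** The [pi]-orbit of [x] is stable under [t], which reflects it about [x], and hence under [s],
    since [s z = t (pi z)]. *)
Lemma connect_fconnect y : connect step x y -> fconnect pi x y.
Proof.
suff cl : closed step (fconnect pi x).
  by move=> /(closed_connect cl); rewrite -!topredE /= connect0 => <-.
apply: intro_closed; first exact: step_connect_sym.
have clt z : fconnect pi x z -> fconnect pi x (t z).
  move=> /iter_findex <-; rewrite fconnect_sym//.
  by rewrite -[X in fconnect _ _ X](iter_pi_t (findex pi x z)) fconnect_iter.
move=> z w /orP[/eqP->|/eqP->] xz; last exact: clt.
rewrite -[s z]tK; apply: clt; apply: (connect_trans xz).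
exact: (fconnect_iter _ 1).
Qed.

(* A fixed point [iter i pi x] of [t] is also [iter (n - i) pi x], [n] being the
   length of the orbit. *)
Let end_index y : t y = y -> y != x -> fconnect pi x y ->
  (findex pi x y).*2 = fingraph.order pi x.
Proof.
move=> ty yx xy; have lt := findex_max xy; have yE := iter_findex xy.
set i := findex pi x y in lt yE *; set n := fingraph.order pi x in lt *.
have i0 : (0 < i)%N.
  by rewrite lt0n; apply: contraNneq yx => i0; rewrite -yE i0.
have ii : iter i.*2 pi x = x.
  by rewrite -addnn iterD yE -ty -[in t y]yE iter_pi_t.
have noloop j : (0 < j < n)%N -> iter j pi x != x.
  move=> /andP[j0 jn]; apply/negP => /eqP e.
  by have := findex_iter jn; rewrite e findex0 => e0; rewrite -e0 in j0.
have [ltn|gtn|//] := ltngtP i.*2 n.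
  by have := noloop i.*2; rewrite ltn double_gt0 i0 ii eqxx => /(_ isT).
have e : iter (i.*2 - n) pi x = x.
  by move: ii; rewrite -{1}(subnK (ltnW gtn)) iterD iter_order.
have := noloop (i.*2 - n)%N; rewrite e eqxx subn_gt0 gtn /= => h.
by exfalso; have /h : (i.*2 - n < n)%N by lia.
Qed.

(** By [end_index], another fixed point of [t] can only sit halfway around the orbit of [x]. *)
Lemma end_unique y z : t y = y -> t z = z -> y != x -> z != x ->
  connect step x y -> connect step x z -> y = z.
Proof.
move=> ty tz yx zx /connect_fconnect xy /connect_fconnect xz.
have e : findex pi x y = findex pi x z.
  by apply: double_inj; rewrite !end_index.
by rewrite -(iter_findex xy) e iter_findex.
Qed.

(** If the orbit of [x] has even length, its midpoint is fixed by [t]. Odd length would give a fixed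
    point of [s], which [s_fix] excludes. *)
Lemma end_exists : exists y, [/\ t y = y, y != x & connect step x y].
Proof.
set n := fingraph.order pi x; have n0 : (0 < n)%N by exact: fingraph.order_gt0.
have pix : iter n pi x = x by exact: iter_order.
have cpi z : connect step z (pi z).
  apply: (connect_trans (connect1 (_ : step z (s z)))); rewrite ?/step ?eqxx//.
  by apply: connect1; rewrite /step eqxx orbT.
have citer k : connect step x (iter k pi x).
  by elim: k => //= k IHk; exact: connect_trans IHk (cpi _).
have [h [nE|nE]] : exists h, n = (h.+1 + h)%N \/ n = (h + h)%N.
  by exists n./2; case: (boolP (odd n)) => ?; [left|right]; lia.
  have := iter_pi_t h.+1; rewrite -[RHS]pix nE iterD => /iter_pi_inj.
  by rewrite iterS /pi tK => e; have := s_fix (iter h pi x); rewrite /pi e eqxx.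
exists (iter h pi x); split => //.
  by have := iter_pi_t h; rewrite -[RHS]pix nE iterD => /iter_pi_inj.
have hn : (h < fingraph.order pi x)%N by rewrite -/n; lia.
apply/negP => /eqP e; have := findex_iter hn; rewrite e findex0.
lia.
Qed.

End From_end.
End Involution_pair.

Lemma connect_homo (T T' : finType) (e : rel T) (e' : rel T') (f : T -> T') :
  (forall x y, e x y -> connect e' (f x) (f y)) ->
  forall x y, connect e x y -> connect e' (f x) (f y).
Proof.
move=> ef x _ /connectP[p ep ->]; elim: p x ep => [|y p IHp] x //=.
by move=> /andP[/ef exy /IHp]; exact: connect_trans.
Qed.

Lemma half_edgeP (i : 'I_4) : [\/ i = he0, i = he1, i = he2 | i = he3].
Proof.
by case: i => [[|[|[|[|?]]]] ?] //;
  [constructor 1|constructor 2|constructor 3|constructor 4]; apply: val_inj.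
Qed.

Section Trails.
Variables (G : gadget) (m : {ffun edge_end (edge G) -> edge_end (edge G)}).
Hypothesis mG : matching_system m.

Lemma matching_systemE d : [/\ m d != d, m (m d) = d & att (m d) = att d].
Proof. by have /forallP/(_ d)/and3P[? /eqP ? /eqP] := mG. Qed.

Lemma oppositeK : involutive (@opposite G).
Proof. by move=> [[e b]|i] //=; rewrite negbK. Qed.

Let mK : involutive m. Proof. by move=> d; have [] := matching_systemE d. Qed.
Let m_fix d : m d != d. Proof. by have [] := matching_systemE d. Qed.

Lemma same_trail_sym : connect_sym (follow m).
Proof. exact: step_connect_sym mK oppositeK. Qed.

Definition joined i j := same_trail m (inr i) (inr j).

Lemma joined_unique i j k : j != i -> k != i -> joined i j -> joined i k -> j = k.
Proof.
move=> ji ki ij ik.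
have [] := @end_unique _ _ _ mK oppositeK (inr i) erefl (inr j) (inr k)
  erefl erefl ji ki ij ik.
by [].
Qed.

Lemma joined_exists i : exists2 j, j != i & joined i j.
Proof.
have [[[e b]|j] [// fj ji ij]] :=
  end_exists mK oppositeK m_fix (x := inr i) erefl.
  by case: fj => /eqP; case: (b).
by exists j.
Qed.

Lemma joined_sym i j : joined i j = joined j i.
Proof. exact: same_trail_sym. Qed.

(** The partner of [he0] decides the case: each half-edge has exactly one partner, so the two
    remaining ones are joined to each other. *)
Lemma joined_cases : [\/ joined he0 he1 /\ joined he2 he3,
  joined he0 he2 /\ joined he1 he3 | joined he0 he3 /\ joined he1 he2].
Proof.
have U i j k : joined i j -> joined i k -> j != i -> k != i -> j == k.
  by move=> ij ik ji ki; apply/eqP; exact: (joined_unique ji ki).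
have [j j0 c0] := joined_exists he0.
case: (half_edgeP j) => jE; rewrite {}jE // in j0 c0 *.
- have [k k2 c2] := joined_exists he2.
  case: (half_edgeP k) => kE; rewrite {}kE // in k2 c2 *.
  + by rewrite joined_sym in c2; have := U _ _ _ c0 c2 isT isT.
  + by rewrite joined_sym in c2; rewrite joined_sym in c0; have := U _ _ _ c0 c2 isT isT.
  + by constructor 1.
- have [k k1 c1] := joined_exists he1.
  case: (half_edgeP k) => kE; rewrite {}kE // in k1 c1 *.
  + by rewrite joined_sym in c1; have := U _ _ _ c0 c1 isT isT.
  + by rewrite joined_sym in c1; rewrite joined_sym in c0; have := U _ _ _ c0 c1 isT isT.
  + by constructor 2.
- have [k k1 c1] := joined_exists he1.
  case: (half_edgeP k) => kE; rewrite {}kE // in k1 c1 *.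
  + by rewrite joined_sym in c1; have := U _ _ _ c0 c1 isT isT.
  + by constructor 3.
  + by rewrite joined_sym in c1; rewrite joined_sym in c0; have := U _ _ _ c0 c1 isT isT.
Qed.

End Trails.

Section Routes_types.
Variable G : gadget.
Implicit Types m : {ffun edge_end (edge G) -> edge_end (edge G)}.

Lemma VR_not_valid m : ~~ valid_routes m ->
  [/\ (m \in VR_alpha G) = false, (m \in VR_beta G) = false
    & (m \in VR_gamma G) = false].
Proof. by move=> /negbTE mv; rewrite !inE mv. Qed.

Lemma VR_disjoint :
  [/\ [disjoint VR_alpha G & VR_beta G], [disjoint VR_alpha G & VR_gamma G]
    & [disjoint VR_beta G & VR_gamma G]].
Proof.
have U (i j k : 'I_4) m : matching_system m -> joined m i j -> joined m i k ->
    j != i -> k != i -> j == k.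
  by move=> mm ij ik ji ki; apply/eqP; exact: (joined_unique mm ji ki).
by split; apply/pred0P => m /=; apply/negP => /andP[];
  rewrite !inE => /and3P[/andP[mm _] h _] /and3P[_ h' _];
  have := U _ _ _ _ mm h h' isT isT.
Qed.

Lemma VR_alpha_only m : m \in VR_alpha G -> [/\ (m \in VR_alpha G) = true,
  (m \in VR_beta G) = false & (m \in VR_gamma G) = false].
Proof.
have [dab dac _] := VR_disjoint.
by move=> h; rewrite h (disjointFr dab h) (disjointFr dac h).
Qed.

Lemma VR_beta_only m : m \in VR_beta G -> [/\ (m \in VR_alpha G) = false,
  (m \in VR_beta G) = true & (m \in VR_gamma G) = false].
Proof.
have [dab _ dbc] := VR_disjoint.
by move=> h; rewrite h (disjointFl dab h) (disjointFr dbc h).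
Qed.

Lemma VR_gamma_only m : m \in VR_gamma G -> [/\ (m \in VR_alpha G) = false,
  (m \in VR_beta G) = false & (m \in VR_gamma G) = true].
Proof.
have [_ dac dbc] := VR_disjoint.
by move=> h; rewrite h (disjointFl dac h) (disjointFl dbc h).
Qed.

Lemma valid_routes_cases m : valid_routes m ->
  [\/ m \in VR_alpha G, m \in VR_beta G | m \in VR_gamma G].
Proof.
move=> mv; have /andP[mm _] := mv.
by case: (joined_cases mm) => -[? ?]; [constructor 1|constructor 2|constructor 3];
  rewrite inE mv /=; apply/andP.
Qed.

End Routes_types.

(** * Gluing routes *)

Section Glued_routes.
Variables G1 G2 : gadget.
Notation G3 := (glue2 G1 G2).
Notation end1 := (edge_end (edge G1)).
Notation end2 := (edge_end (edge G2)).
Notation end3 := (edge_end (edge G3)).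
Notation matching1 := {ffun end1 -> end1}.
Notation matching2 := {ffun end2 -> end2}.
Notation matching3 := {ffun end3 -> end3}.

Let glued : end3 -> end1 + end2 := @glue_end G1 G2.

(** An inverse of [glue_end] given by cases, so that it computes; [glue_end_bij] only asserts that
    one exists. *)
Definition unglue_end (x : end1 + end2) : end3 :=
  match x with
  | inl (inl (e, b)) => inl (inl (inl e), b)
  | inl (inr (Ordinal 2 _)) => inl (inr false, false)
  | inl (inr (Ordinal 3 _)) => inl (inr true, false)
  | inl (inr i) => inr i
  | inr (inl (e, b)) => inl (inl (inr e), b)
  | inr (inr (Ordinal 0 _)) => inl (inr true, true)
  | inr (inr (Ordinal 1 _)) => inl (inr false, true)
  | inr (inr i) => inr i
  end.

Lemma unglue_endK : cancel unglue_end glued.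
Proof.
by move=> [[[e b]|[[|[|[|[|i]]]] Hi]]|[[e b]|[[|[|[|[|i]]]] Hi]]] //=;
  do 2 congr (_ _); apply: val_inj.
Qed.

Lemma glue_endK : cancel glued unglue_end.
Proof. by move=> d; apply: glue_end_inj; exact: unglue_endK. Qed.

Definition glue_matching (m1 : matching1) (m2 : matching2) : matching3 :=
  [ffun d => unglue_end match glued d with
     | inl x => inl (m1 x)
     | inr y => inr (m2 y)
     end].

Lemma glue_matchingE1 m1 m2 x :
  glue_matching m1 m2 (unglue_end (inl x)) = unglue_end (inl (m1 x)).
Proof. by rewrite ffunE unglue_endK. Qed.

Lemma glue_matchingE2 m1 m2 y :
  glue_matching m1 m2 (unglue_end (inr y)) = unglue_end (inr (m2 y)).
Proof. by rewrite ffunE unglue_endK. Qed.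

Definition glue_matchingE := (glue_matchingE1, glue_matchingE2).

Lemma glue_matching_inj m1 m2 m1' m2' :
  glue_matching m1 m2 = glue_matching m1' m2' -> m1 = m1' /\ m2 = m2'.
Proof.
move=> /ffunP e; split; apply/ffunP => x.
  have := e (unglue_end (inl x)); rewrite !glue_matchingE.
  by move=> /(can_inj unglue_endK)[].
have := e (unglue_end (inr x)); rewrite !glue_matchingE.
by move=> /(can_inj unglue_endK)[].
Qed.

Lemma att_unglue x : @att G3 (unglue_end x) =
  match x with inl x => inl (att x) | inr y => inr (att y) end.
Proof. by rewrite [LHS]/(glue_att _) /glue_att -/glued unglue_endK. Qed.

Lemma glue_matching_system m1 m2 :
  matching_system (glue_matching m1 m2) = matching_system m1 && matching_system m2.
Proof.
have inj := can_inj unglue_endK.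
apply/forallP/andP => [h|[/forallP h1 /forallP h2] d].
  split; apply/forallP => x.
    have := h (unglue_end (inl x)).
    by rewrite !glue_matchingE !(inj_eq inj) !att_unglue.
  have := h (unglue_end (inr x)).
  by rewrite !glue_matchingE !(inj_eq inj) !att_unglue.
rewrite -[d]glue_endK; case: (glued d) => x.
  by rewrite !glue_matchingE !(inj_eq inj) !att_unglue; apply: h1.
by rewrite !glue_matchingE !(inj_eq inj) !att_unglue; apply: h2.
Qed.

(** A matching preserves attachment vertices, so it never leads from one part to the other; the
    default values [x] and [y] below are never reached. *)
Lemma glue_matching_surj (m : matching3) : matching_system m ->
  exists m1 m2, m = glue_matching m1 m2.
Proof.
move=> mm; have matt x := let: And3 _ _ e := matching_systemE mm x in e.
exists [ffun x => if glued (m (unglue_end (inl x))) is inl x' then x' else x].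
exists [ffun y => if glued (m (unglue_end (inr y))) is inr y' then y' else y].
apply/ffunP => d; rewrite ffunE -[in LHS](glue_endK d).
case: (glued d) => x; rewrite ffunE.
  have := matt (unglue_end (inl x)).
  rewrite -[m _]glue_endK !att_unglue unglue_endK.
  by case: (glued _).
have := matt (unglue_end (inr x)).
rewrite -[m _]glue_endK !att_unglue unglue_endK.
by case: (glued _).
Qed.

Section Trails_of_glue.
Variables (m1 : matching1) (m2 : matching2).
Hypotheses (mm1 : matching_system m1) (mm2 : matching_system m2).
Let m := glue_matching m1 m2.

Let mm : matching_system m. Proof. by rewrite glue_matching_system mm1 mm2. Qed.

Lemma same_trail_inl x y : same_trail m1 x y ->
  same_trail m (unglue_end (inl x)) (unglue_end (inl y)).
Proof.
apply: (connect_homo (f := fun x => unglue_end (inl x))) => {}x {}y.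
move=> /orP[/eqP->|/eqP->].
  by apply: connect1; rewrite /follow glue_matchingE eqxx.
(* A half-edge is its own opposite in [G1], even if it becomes an end of a new edge in the glue. *)
case: x => [[e b]|i]; last exact: connect0.
by apply: connect1; rewrite /follow eqxx orbT.
Qed.

Lemma same_trail_inr x y : same_trail m2 x y ->
  same_trail m (unglue_end (inr x)) (unglue_end (inr y)).
Proof.
apply: (connect_homo (f := fun x => unglue_end (inr x))) => {}x {}y.
move=> /orP[/eqP->|/eqP->].
  by apply: connect1; rewrite /follow glue_matchingE eqxx.
case: x => [[e b]|i]; last exact: connect0.
by apply: connect1; rewrite /follow eqxx orbT.
Qed.

Lemma same_trail_bridge :
  same_trail m (unglue_end (inl (inr he3))) (unglue_end (inr (inr he0))) /\
  same_trail m (unglue_end (inl (inr he2))) (unglue_end (inr (inr he1))).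
Proof. by split; apply: connect1; rewrite /follow eqxx orbT. Qed.

(* A union of trails of the two parts that agrees along the two new edges is a
   union of trails of the glue. *)
Lemma same_trail_invariant (A : pred end1) (B : pred end2) d d' :
  (forall x y, same_trail m1 x y -> A x = A y) ->
  (forall x y, same_trail m2 x y -> B x = B y) ->
  A (inr he3) = B (inr he0) -> A (inr he2) = B (inr he1) ->
  same_trail m d d' ->
  match glued d with inl x => A x | inr y => B y end =
  match glued d' with inl x => A x | inr y => B y end.
Proof.
move=> hA hB e3 e2.
pose Q d := match glued d with inl x => A x | inr y => B y end.
suff cl : closed (follow m) Q by move=> /(closed_connect cl).
move=> {d d'} d d' /orP[/eqP->|/eqP->]; rewrite -!topredE /= /Q.
  rewrite ffunE unglue_endK; case: (glued d) => x.
    by apply: hA; apply: connect1; rewrite /follow eqxx.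
  by apply: hB; apply: connect1; rewrite /follow eqxx.
case: d => [[[[e|e]|[]] b]|i] //=.
- by apply: hA; apply: connect1; rewrite /follow eqxx orbT.
- by apply: hB; apply: connect1; rewrite /follow eqxx orbT.
- by case: b.
- by case: b.
Qed.

(** A closed trail of one part meets no half-edge, so gluing leaves it closed. The invariant is this
    trail in its own part and the empty set in the other. *)
Lemma valid_glue_parts : valid_routes m -> valid_routes m1 /\ valid_routes m2.
Proof.
move=> /andP[_ /forallP mv]; rewrite /valid_routes mm1 mm2; split;
  apply/forallP => x; apply: contraT => /existsPn n.
  have /existsP[i xi] := mv (unglue_end (inl x)).
  have := @same_trail_invariant (same_trail m1 x) pred0 _ _ _ _ _ _ xi.
  have xx : same_trail m1 x x = true by exact: connect0.
  rewrite unglue_endK /= xx !(negbTE (n _)) => h.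
  have : true = match glued (inr i) with inl z => same_trail m1 x z | inr _ => false end.
    apply: h => // y z yz; exact/(same_connect_r (same_trail_sym mm1)).
  by rewrite /glued /=; case: ifP; rewrite ?(negbTE (n _)).
have /existsP[i xi] := mv (unglue_end (inr x)).
have := @same_trail_invariant pred0 (same_trail m2 x) _ _ _ _ _ _ xi.
have xx : same_trail m2 x x = true by exact: connect0.
rewrite unglue_endK /= xx !(negbTE (n _)) => h.
have : true = match glued (inr i) with inl _ => false | inr z => same_trail m2 x z end.
  apply: h => // y z yz; exact/(same_connect_r (same_trail_sym mm2)).
by rewrite /glued /=; case: ifP; rewrite ?(negbTE (n _)).
Qed.

(** The two new edges close up the route between half-edges 2 and 3 of [G1] and the one between 0
    and 1 of [G2]. *)
Lemma not_valid_alpha_alpha : m1 \in VR_alpha G1 -> m2 \in VR_alpha G2 ->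
  ~~ valid_routes m.
Proof.
rewrite !inE => /and3P[_ p01 p23] /and3P[_ q01 q23].
apply/negP => /andP[_ /forallP mv].
have U1 (i j k : 'I_4) : joined m1 i j -> joined m1 i k -> j != i -> k != i -> j == k.
  by move=> ij ik ji ki; apply/eqP; exact: (joined_unique mm1 ji ki).
have U2 (i j k : 'I_4) : joined m2 i j -> joined m2 i k -> j != i -> k != i -> j == k.
  by move=> ij ik ji ki; apply/eqP; exact: (joined_unique mm2 ji ki).
have /existsP[i xi] := mv (unglue_end (inl (inr he3))).
have := @same_trail_invariant (same_trail m1 (inr he3)) (same_trail m2 (inr he0))
  _ _ _ _ _ _ xi.
have xx1 : same_trail m1 (inr he3) (inr he3) = true by exact: connect0.
have xx2 : same_trail m2 (inr he0) (inr he0) = true by exact: connect0.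
rewrite unglue_endK xx1 xx2 => h.
have {}h : true = match glued (inr i) with
  inl z => same_trail m1 (inr he3) z | inr z => same_trail m2 (inr he0) z end.
  apply: h => [y z yz|y z yz||].
  - exact/(same_connect_r (same_trail_sym mm1)).
  - exact/(same_connect_r (same_trail_sym mm2)).
  - by [].
  - by rewrite q01 -/(joined m1 he3 he2) (joined_sym mm1); exact: p23.
have p32 : joined m1 he3 he2 by rewrite (joined_sym mm1).
move: h {xi}; case: i => [[|[|[|[|?]]]] lt] //= /esym h.
- by have := U1 he3 (Ordinal lt) he2 h p32 isT isT.
- by have := U1 he3 (Ordinal lt) he2 h p32 isT isT.
- by have := U2 he0 (Ordinal lt) he1 h q01 isT isT.
- by have := U2 he0 (Ordinal lt) he1 h q01 isT isT.
Qed.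

(** Every end of a part shares a trail with a half-edge of that part, so only the trails of these
    half-edges have to be followed in the glue. *)
Lemma valid_glue : valid_routes m1 -> valid_routes m2 ->
  (forall i, exists j : 'I_4, same_trail m (unglue_end (inl (inr i))) (inr j)) ->
  (forall i, exists j : 'I_4, same_trail m (unglue_end (inr (inr i))) (inr j)) ->
  valid_routes m.
Proof.
move=> /andP[_ /forallP v1] /andP[_ /forallP v2] h1 h2.
apply/andP; split => //; apply/forallP => d; apply/existsP.
rewrite -[d]glue_endK; case: (glued d) => x.
  have /existsP[i xi] := v1 x; have [j ij] := h1 i.
  by exists j; exact: connect_trans (same_trail_inl xi) ij.
have /existsP[i xi] := v2 x; have [j ij] := h2 i.
by exists j; exact: connect_trans (same_trail_inr xi) ij.
Qed.

Let rt d := fingraph.root (follow m) d.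

Lemma same_trail_root x y : same_trail m x y <-> rt x = rt y.
Proof.
by split => /(fingraph.rootP (same_trail_sym mm)).
Qed.

(** Labelling trails by their roots turns connectivity into equality. As [conn] ranges over
    arbitrary labellings [x1], [x2], [x] of the half-edges of [G1], [G2] and the glue, it is purely
    equational and within reach of [congruence]. Its last four clauses say that each half-edge
    absorbed by a new edge still reaches a free one, so that no closed trail appears. *)
Lemma VR_glue_intro (p q r s p' q' r' s' i j k l : 'I_4) :
  m1 \in VR G1 p q r s -> m2 \in VR G2 p' q' r' s' ->
  (forall T (x1 x2 x : 'I_4 -> T),
    x1 p = x1 q -> x1 r = x1 s -> x2 p' = x2 q' -> x2 r' = x2 s' ->
    x1 he3 = x2 he0 -> x1 he2 = x2 he1 ->
    x1 he0 = x he0 -> x1 he1 = x he1 -> x2 he2 = x he2 -> x2 he3 = x he3 ->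
    [/\ x i = x j, x k = x l &
      [/\ exists h, x1 he2 = x h, exists h, x1 he3 = x h,
          exists h, x2 he0 = x h & exists h, x2 he1 = x h]]) ->
  m \in VR G3 i j k l.
Proof.
rewrite !inE => /and3P[v1 pq rs] /and3P[v2 pq' rs'] conn.
have [/same_trail_root b3 /same_trail_root b2] := same_trail_bridge.
have /same_trail_root {}pq := same_trail_inl pq.
have /same_trail_root {}rs := same_trail_inl rs.
have /same_trail_root {}pq' := same_trail_inr pq'.
have /same_trail_root {}rs' := same_trail_inr rs'.
have [ij kl [x2 x3 y0 y1]] := conn _ (fun h => rt (unglue_end (inl (inr h))))
  (fun h => rt (unglue_end (inr (inr h)))) (fun h => rt (inr h))
  pq rs pq' rs' b3 b2 erefl erefl erefl erefl.
apply/and3P; split; [|exact/same_trail_root|exact/same_trail_root].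
apply: valid_glue => // h; case: (half_edgeP h) => ->.
- by exists he0; apply/same_trail_root.
- by exists he1; apply/same_trail_root.
- by case: x2 => h' ?; exists h'; apply/same_trail_root.
- by case: x3 => h' ?; exists h'; apply/same_trail_root.
- by case: y0 => h' ?; exists h'; apply/same_trail_root.
- by case: y1 => h' ?; exists h'; apply/same_trail_root.
- by exists he2; apply/same_trail_root.
- by exists he3; apply/same_trail_root.
Qed.

Local Ltac chase :=
  eapply VR_glue_intro; [eassumption|eassumption|];
  move=> *; split; [congruence|congruence|split];
  first [exists he0; congruence | exists he1; congruence
        | exists he2; congruence | exists he3; congruence].

Lemma VR_glue :
  [/\ (m \in VR_alpha G3) =
        (m1 \in VR_alpha G1) && ((m2 \in VR_beta G2) || (m2 \in VR_gamma G2))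
        || ((m1 \in VR_beta G1) || (m1 \in VR_gamma G1)) && (m2 \in VR_alpha G2),
      (m \in VR_beta G3) =
        (m1 \in VR_beta G1) && (m2 \in VR_gamma G2)
        || (m1 \in VR_gamma G1) && (m2 \in VR_beta G2)
    & (m \in VR_gamma G3) =
        (m1 \in VR_beta G1) && (m2 \in VR_beta G2)
        || (m1 \in VR_gamma G1) && (m2 \in VR_gamma G2)].
Proof.
have [/andP[v1 v2]|nv] := boolP (valid_routes m1 && valid_routes m2); last first.
  have /VR_not_valid[-> -> ->] : ~~ valid_routes m.
    by apply: contra nv => /valid_glue_parts[-> ->].
  move: nv; rewrite negb_and => /orP[] /VR_not_valid[-> -> ->] //.
  by rewrite !andbF.
case: (valid_routes_cases v1) => h1; case: (valid_routes_cases v2) => h2.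
- have [-> -> ->] := VR_alpha_only h1; have [-> -> ->] := VR_alpha_only h2.
  by apply: VR_not_valid; exact: not_valid_alpha_alpha.
- have [-> -> ->] := VR_alpha_only h1; have [-> -> ->] := VR_beta_only h2.
  by apply: VR_alpha_only; chase.
- have [-> -> ->] := VR_alpha_only h1; have [-> -> ->] := VR_gamma_only h2.
  by apply: VR_alpha_only; chase.
- have [-> -> ->] := VR_beta_only h1; have [-> -> ->] := VR_alpha_only h2.
  by apply: VR_alpha_only; chase.
- have [-> -> ->] := VR_beta_only h1; have [-> -> ->] := VR_beta_only h2.
  by apply: VR_gamma_only; chase.
- have [-> -> ->] := VR_beta_only h1; have [-> -> ->] := VR_gamma_only h2.
  by apply: VR_beta_only; chase.
- have [-> -> ->] := VR_gamma_only h1; have [-> -> ->] := VR_alpha_only h2.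
  by apply: VR_alpha_only; chase.
- have [-> -> ->] := VR_gamma_only h1; have [-> -> ->] := VR_beta_only h2.
  by apply: VR_beta_only; chase.
- have [-> -> ->] := VR_gamma_only h1; have [-> -> ->] := VR_gamma_only h2.
  by apply: VR_gamma_only; chase.
Qed.

End Trails_of_glue.

Let gluep (p : matching1 * matching2) := glue_matching p.1 p.2.

Lemma card_VR_glue :
  [/\ #|VR_alpha G3| = (#|VR_alpha G1| * (#|VR_beta G2| + #|VR_gamma G2|)
        + (#|VR_beta G1| + #|VR_gamma G1|) * #|VR_alpha G2|)%N,
      #|VR_beta G3| = (#|VR_beta G1| * #|VR_gamma G2|
        + #|VR_gamma G1| * #|VR_beta G2|)%N
    & #|VR_gamma G3| = (#|VR_beta G1| * #|VR_beta G2|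
        + #|VR_gamma G1| * #|VR_gamma G2|)%N].
Proof.
have inj : injective gluep by move=> [? ?] [? ?] /glue_matching_inj /= [-> ->].
(* Since [gluep] is injective and reaches every matching system of the glue, glued matchings are
   counted as pairs. *)
have imE (A : {set matching3}) (B : {set matching1 * matching2}) :
    (forall f, f \in A -> matching_system f) ->
    (forall p, p \in B -> matching_system p.1 && matching_system p.2) ->
    (forall m1 m2, matching_system m1 -> matching_system m2 ->
       (glue_matching m1 m2 \in A) = ((m1, m2) \in B)) -> #|A| = #|B|.
  move=> hA hB h; rewrite -(card_imset _ inj); apply: eq_card => f.
  apply/idP/imsetP => [fA|[[f1 f2] fB ->]]; last first.
    by have /andP[/= ? ?] := hB _ fB; rewrite /gluep h.
  have [f1 [f2 fE]] := glue_matching_surj (hA _ fA).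
  have := hA _ fA; rewrite fE glue_matching_system => /andP[? ?].
  by exists (f1, f2) => //; rewrite -h// -fE.
have ms G a b c d f : f \in @VR G a b c d -> matching_system f.
  by rewrite inE => /and3P[/andP[]].
have [dab1 dac1 dbc1] := VR_disjoint G1; have [dab2 dac2 dbc2] := VR_disjoint G2.
have cU (T : finType) (A B : {set T}) : [disjoint A & B] -> #|A :|: B| = (#|A| + #|B|)%N.
  by rewrite cardsU -setI_eq0 => /eqP ->; rewrite cards0 subn0.
have dX (A A' : {set matching1}) (B B' : {set matching2}) : [disjoint A & A'] ->
    [disjoint setX A B & setX A' B'].
  move=> dA; apply/pred0P => -[x y] /=; rewrite !in_setX.
  by apply/negP => /andP[/andP[/(disjointFr dA) -> _]].
split.
- rewrite -!cU// -!cardsX -cU; last first.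
    by apply: dX; rewrite -setI_eq0 setIUr setU_eq0 !setI_eq0 dab1.
  apply: imE => [f /ms//|[f1 f2]|f1 f2 g1 g2].
    rewrite !(in_setU, in_setX) /= => /orP[/andP[+ /orP[]]|/andP[/orP[]]];
      by move=> /ms -> /ms ->.
  by have [-> _ _] := VR_glue g1 g2; rewrite !(in_setU, in_setX).
- rewrite -!cardsX -cU; last exact: dX.
  apply: imE => [f /ms//|[f1 f2]|f1 f2 g1 g2].
    by rewrite !(in_setU, in_setX) /= => /orP[] /andP[/ms -> /ms ->].
  by have [_ -> _] := VR_glue g1 g2; rewrite in_setU !in_setX.
- rewrite -!cardsX -cU; last exact: dX.
  apply: imE => [f /ms//|[f1 f2]|f1 f2 g1 g2].
    by rewrite !(in_setU, in_setX) /= => /orP[] /andP[/ms -> /ms ->].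
  by have [_ _ ->] := VR_glue g1 g2; rewrite in_setU !in_setX.
Qed.

End Glued_routes.

(** * The boundary of S *)

From mathcomp Require Import topology normedtype derive realfun.
Import numFieldNormedType.Exports.
Local Open Scope ring_scope.

Section Pointwise_derivatives.
Context {R : realType}.
Implicit Types (f g : R -> R) (x a b : R).

(** The derivative rules are restated for explicit lambda expressions, the shape of the functions
    differentiated below. *)
Lemma derive_add f g x a b : is_derive x 1 f a -> is_derive x 1 g b ->
  is_derive x 1 (fun y => f y + g y) (a + b).
Proof. exact: is_deriveD. Qed.

Lemma derive_opp f x a : is_derive x 1 f a -> is_derive x 1 (fun y => - f y) (- a).
Proof. exact: is_deriveN. Qed.

Lemma derive_mul f g x a b : is_derive x 1 f a -> is_derive x 1 g b ->
  is_derive x 1 (fun y => f y * g y) (f x * b + g x * a).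
Proof. exact: is_deriveM. Qed.

Lemma derive_inv f x a : f x != 0 -> is_derive x 1 f a ->
  is_derive x 1 (fun y => (f y)^-1) (- (f x) ^- 2 * a).
Proof. by move=> f0 fa; exact: is_deriveV. Qed.

Lemma derive_comp f g x a b : is_derive (g x) 1 f a -> is_derive x 1 g b ->
  is_derive x 1 (fun y => f (g y)) (b * a).
Proof. by move=> fa gb; rewrite mulrC; exact: is_derive1_comp. Qed.

Lemma derive_cst x a : is_derive x 1 (fun=> a) 0.
Proof. exact: is_derive_cst. Qed.

Lemma derive_id x : is_derive x 1 (fun y : R => y) 1.
Proof. exact: is_derive_id. Qed.

Lemma derive_ge0_le f df a b : a <= b ->
  (forall x, a <= x <= b -> is_derive x 1 f (df x)) ->
  (forall x, a <= x <= b -> 0 <= df x) -> f a <= f b.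
Proof.
move=> ab fd d0.
have [ | |c] := @MVT_segment _ f df a b ab.
- by move=> x; rewrite in_itv /= => /andP[ax xb]; apply: fd; rewrite !ltW.
- apply: derivable_within_continuous => x; rewrite in_itv /= => xab.
  by have [] := fd x xab.
rewrite in_itv /= => cab e.
by rewrite -subr_ge0 e mulr_ge0 ?subr_ge0// d0.
Qed.

End Pointwise_derivatives.

(** * The function ln ((1 + y) / (1 - y)) *)

Section Log_ratio.
Context {R : realType}.
Implicit Types y z : R.

(** This is [2 artanh y]. *)
Definition log_ratio y := ln ((1 + y) / (1 - y)).

Lemma is_derive_log_ratio y : 0 <= y < 1 ->
  is_derive y 1 log_ratio (2 / (1 - y ^+ 2)).
Proof.
move=> /andP[y0 y1].
have n1 : 1 - y != 0 by lra.
have n2 : 1 + y != 0 by lra.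
have n3 : 1 - y ^+ 2 != 0 by rewrite (_ : _ - _ = (1 - y) * (1 + y)) ?mulf_neq0//; ring.
apply: is_derive_eq.
  rewrite /log_ratio; apply: (@derive_comp _ (@ln R) (fun x => (1 + x) / (1 - x))).
    by apply: is_derive1_ln; rewrite divr_gt0; lra.
by rewrite /= /GRing.scale /=; field; rewrite n1 n2 n3.
Qed.

Lemma log_ratio_ge y : 0 <= y < 1 -> 2 * y <= log_ratio y.
Proof.
move=> /andP[y0 y1].
have h : log_ratio 0 - 2 * 0 <= log_ratio y - 2 * y.
  apply: (@derive_ge0_le R (fun x => log_ratio x - 2 * x)
            (fun x => 2 / (1 - x ^+ 2) - 2) 0 y y0) => x /andP[x0 xy].
    have dx : is_derive x 1 log_ratio (2 / (1 - x ^+ 2)).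
      by apply: is_derive_log_ratio; lra.
    by apply: is_derive_eq; rewrite /GRing.scale /=; ring.
  have x2 : 0 < 1 - x ^+ 2 by nra.
  by rewrite subr_ge0 ler_pdivlMr//; nra.
by move: h; rewrite {1}/log_ratio addr0 subr0 divr1 ln1; lra.
Qed.

Lemma log_ratio_le y : 0 <= y < 1 -> log_ratio y <= 2 * y / (1 - y).
Proof.
move=> /andP[y0 y1]; rewrite /log_ratio.
have n1 : 1 - y != 0 by lra.
rewrite (_ : (1 + y) / (1 - y) = 1 + 2 * y / (1 - y)); last by field.
by apply: le_ln1Dx; apply: lt_le_trans (_ : 0 <= _); [lra|rewrite divr_ge0; lra].
Qed.

(** Both slopes introduced below are explicit multiples of values of [psi]. *)
Definition psi y := (1 + y^-1) * log_ratio y.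

Lemma is_derive_psi y : 0 < y < 1 ->
  is_derive y 1 psi (2 / (y * (1 - y)) - log_ratio y / y ^+ 2).
Proof.
move=> /andP[y0 y1].
have n0 : y != 0 by lra.
have n1 : 1 - y != 0 by lra.
have n2 : 1 + y != 0 by lra.
have n3 : 1 - y ^+ 2 != 0 by rewrite (_ : _ - _ = (1 - y) * (1 + y)) ?mulf_neq0//; ring.
have dL : is_derive y 1 log_ratio (2 / (1 - y ^+ 2)).
  by apply: is_derive_log_ratio; lra.
apply: (is_derive_eq (derive_mul (derive_add (derive_cst y 1)
  (derive_inv n0 (derive_id y))) dL)).
by field; rewrite n1 n0 n3.
Qed.

(** Nonnegativity of the derivative amounts to [log_ratio_le]. *)
Lemma psi_le y z : 0 < y -> y <= z -> z < 1 -> psi y <= psi z.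
Proof.
move=> y0 yz z1.
apply: (derive_ge0_le yz) => x /andP[xy xz].
  by apply: is_derive_psi; lra.
have x0 : 0 < x by lra.
rewrite subr_ge0 ler_pdivrMr ?exprn_gt0//.
apply: le_trans (log_ratio_le _) _; first lra.
rewrite le_eqVlt; apply/orP; left; apply/eqP.
by field; rewrite !gt_eqF//; lra.
Qed.

Lemma psi_ge y : 0 < y < 1 -> 2 * (1 + y) <= psi y.
Proof.
move=> /andP[y0 y1]; rewrite /psi.
have /= := @log_ratio_ge y; rewrite (ltW y0) y1 => /(_ isT) h.
rewrite (_ : 2 * (1 + y) = (1 + y^-1) * (2 * y)); last by field; rewrite gt_eqF.
by rewrite ler_wpM2l// addr_ge0// invr_ge0 ltW.
Qed.

End Log_ratio.

(** * Monotonicity of the slopes along the boundary curves *)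

Section Boundary_slopes.
Context {R : realType}.
Implicit Types x z E : R.

Lemma expRN_bounds z : 0 < z ->
  [/\ 0 < expR (- z), expR (- z) < 1, 1 - z < expR (- z) &
      expR (- z) * (1 + z) <= 1].
Proof.
move=> z0; split; first exact: expR_gt0.
- by rewrite expR_lt1 oppr_lt0.
- by apply: expR_gt1Dx; rewrite oppr_eq0 gt_eqF.
- by rewrite -[leRHS](expRxMexpNx_1 z) [leRHS]mulrC ler_pM2l ?expR_gt0// expR_ge1Dx.
Qed.

Lemma log_ratio_frac (a b : R) : 0 < a -> log_ratio (b / a) = ln ((a + b) / (a - b)).
Proof.
move=> a0; rewrite /log_ratio; congr ln.
rewrite (_ : 1 + b / a = (a + b) / a); last by field; rewrite gt_eqF.
rewrite (_ : 1 - b / a = (a - b) / a); last by field; rewrite gt_eqF.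
by rewrite invfM invrK mulrACA mulVf ?gt_eqF// mulr1.
Qed.

(* With [E = expR (- z)], these are the slopes [- ln t / u] along the lower and
   the upper curve; see [slope_lowE] and [slope_upE]. *)
Definition slope_low z E :=
  ln ((1 + E + z) / (1 + E - z)) * ((1 + E + z) / (1 - E)).

Definition slope_up z E :=
  ln ((z + (1 - E)) / (z - (1 - E))) * ((z + (1 - E)) / (1 + E)).

Lemma slope_low_psi z E : 0 < z -> 0 < E < 1 ->
  slope_low z E = z / (1 - E) * psi (z / (1 + E)).
Proof.
move=> z0 /andP[E0 E1]; rewrite /slope_low /psi log_ratio_frac; last by lra.
by field; rewrite !gt_eqF//; lra.
Qed.

Lemma slope_up_psi z E : 0 < z -> 0 < E < 1 ->
  slope_up z E = (1 - E) / (1 + E) * psi ((1 - E) / z).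
Proof.
move=> z0 /andP[E0 E1]; rewrite /slope_up /psi log_ratio_frac//.
by field; rewrite !gt_eqF//; lra.
Qed.

(** By [slope_low_psi] the slope is a product of two nonnegative nondecreasing factors;
    [z' < 1 + expR (- z')] keeps the argument of [psi] below 1. *)
Lemma slope_low_mono z z' : 0 < z -> z <= z' -> z' < 1 + expR (- z') ->
  slope_low z (expR (- z)) <= slope_low z' (expR (- z')).
Proof.
move=> z0 zz z1.
have z'0 : 0 < z' by exact: lt_le_trans zz.
have [e0 e1 ez ez'] := expRN_bounds z0.
have [f0 f1 fz fz'] := expRN_bounds z'0.
have fe : expR (- z') <= expR (- z) by rewrite ler_expR lerN2.
have fe' : expR (- z) * (1 - (z' - z)) <= expR (- z').
  rewrite (_ : - z' = - z + - (z' - z)); last by ring.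
  by rewrite expRD ler_pM2l// expR_ge1Dx.
rewrite !slope_low_psi ?e0 ?f0//.
set e := expR (- z) in e0 e1 ez ez' fe fe' *.
set f := expR (- z') in f0 f1 fz fz' fe fe' z1 *.
have p1 : z / (1 + e) <= z' / (1 + f).
  by apply: ler_pM; rewrite ?invr_ge0 ?lef_pV2 ?posrE; lra.
have p0 : 0 < z / (1 + e) by apply: divr_gt0; lra.
apply: ler_pM.
- by apply: divr_ge0; lra.
- apply: le_trans (psi_ge (y := z / (1 + e)) _); first by lra.
  by rewrite p0 (le_lt_trans p1)// ltr_pdivrMr; lra.
(* For the factor [z / (1 - e)], write [z' * e - z * f = (z' - z) * e + z * (e - f)], bound [e - f]
   by [fe'] and use [e * (1 + z) <= 1]. *)
- have h1 : z * (e - f) <= z * (e * (z' - z)).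
    by rewrite ler_pM2l//; lra.
  have h2 : (z' - z) * (e * (1 + z)) <= (z' - z) * 1.
    by rewrite ler_wpM2l//; lra.
  rewrite ler_pdivrMr ?subr_gt0// mulrAC ler_pdivlMr ?subr_gt0//.
  lra.
- by apply: psi_le => //; rewrite ltr_pdivrMr; lra.
Qed.

(** This is [tanh (z / 2) <= z / 2], obtained from [log_ratio_ge] at [y = tanh (z / 2)], where
    [log_ratio y = z]. *)
Lemma tanh_half_le z : 0 < z -> 2 * (1 - expR (- z)) <= z * (1 + expR (- z)).
Proof.
move=> z0; have [e0 e1 _ _] := expRN_bounds z0.
have p0 : 0 < 1 + expR (- z) by lra.
have : 2 * ((1 - expR (- z)) / (1 + expR (- z))) <=
       log_ratio ((1 - expR (- z)) / (1 + expR (- z))).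
  apply: log_ratio_ge; rewrite divr_ge0 ?ltr_pdivrMr//; lra.
rewrite log_ratio_frac// (_ : _ / (_ - _) = (expR (- z))^-1); last first.
  by field; rewrite expR_eq0 /= gt_eqF//; lra.
by rewrite -expRN opprK expRK mulrA ler_pdivrMr.
Qed.

(** Unlike on the lower curve, the factors move in opposite directions: [(1 - E) / (1 + E)]
    increases and [psi ((1 - E) / z)] decreases. Hence the derivative of the product has to be
    estimated. *)
Lemma slope_up_mono z z' : 0 < z -> z <= z' -> z' <= 1 + expR (- z') ->
  slope_up z (expR (- z)) <= slope_up z' (expR (- z')).
Proof.
move=> z0 zz z1.
have z'0 : 0 < z' by exact: lt_le_trans zz.
have pos x : 0 < x -> 0 < expR (- x) < 1.
  by move=> /expRN_bounds[-> ->].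
rewrite !slope_up_psi ?pos//.
pose df x := (1 - expR (- x)) / (1 + expR (- x)) *
    ((expR (- x) * x - (1 - expR (- x))) / x ^+ 2 *
     (2 / ((1 - expR (- x)) / x * (1 - (1 - expR (- x)) / x)) -
      log_ratio ((1 - expR (- x)) / x) / ((1 - expR (- x)) / x) ^+ 2)) +
    psi ((1 - expR (- x)) / x) * (2 * expR (- x) / (1 + expR (- x)) ^+ 2).
apply: (@derive_ge0_le R (fun x => (1 - expR (- x)) / (1 + expR (- x)) *
  psi ((1 - expR (- x)) / x)) df z z' zz) => x /andP[zx xz].
  have x0 : 0 < x by lra.
  have [e0 e1 ex ex'] := expRN_bounds x0.
  have x0' : x != 0 by rewrite gt_eqF.
  have p0' : 1 + expR (- x) != 0 by rewrite gt_eqF//; lra.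
  have dE := derive_comp (is_derive_expR (- x)) (derive_opp (derive_id x)).
  have dS := derive_add (derive_cst x 1) (derive_opp dE).
  have dP := derive_add (derive_cst x 1) dE.
  have dY := derive_mul dS (derive_inv x0' (derive_id x)).
  have y01 : 0 < (1 - expR (- x)) / x < 1.
    by rewrite divr_gt0 ?ltr_pdivrMr//; lra.
  have dpsi := derive_comp (g := fun y => (1 - expR (- y)) / y) (is_derive_psi y01) dY.
  have dV := derive_inv (f := fun y => 1 + expR (- y)) p0' dP.
  apply: (is_derive_eq (derive_mul (derive_mul dS dV) dpsi)).
  rewrite /df; congr (_ * (_ * _) + _ * _); by field; rewrite ?x0' ?p0'.
have x0 : 0 < x by lra.
have [e0 e1 ex ex'] := expRN_bounds x0.
have th := tanh_half_le x0.
have xe : x <= 1 + expR (- x).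
  by apply: (le_trans xz); apply: (le_trans z1); rewrite lerD2l ler_expR lerN2.
rewrite {}/df; set e := expR (- x) in e0 e1 ex ex' th xe *.
set y := (1 - e) / x.
have y01 : 0 < y < 1 by rewrite divr_gt0 ?ltr_pdivrMr//; lra.
(* The bound [h1] on [psi] and the bound [h2] on its derivative eliminate the logarithm and leave a
   rational inequality in [x] and [e]. *)
have h1 := psi_ge y01.
have h2 : 2 / (y * (1 - y)) - log_ratio y / y ^+ 2 <= 2 / (1 - y).
  have /= h := @log_ratio_ge R y.
  have := h _; move/andP: y01 => [y0 y1]; rewrite (ltW y0) y1 => /(_ isT) {}h.
  have {}h : 2 / y <= log_ratio y / y ^+ 2.
    rewrite (_ : 2 / y = 2 * y / y ^+ 2) ?ler_pM2r ?invr_gt0 ?exprn_gt0//.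
    by field; rewrite gt_eqF.
  apply: (le_trans (lerD (lexx _) (_ : _ <= - (2 / y)))); first by rewrite lerN2.
  by rewrite le_eqVlt; apply/orP; left; apply/eqP; field; rewrite !gt_eqF//; lra.
(* At [x = k], the lower bound of [x] given by [tanh_half_le], the difference of
   the two sides is a positive multiple of [quad]. *)
have key : (1 - e) * (1 + e) * (1 - e - e * x) <= 2 * e * (x ^+ 2 - (1 - e) ^+ 2).
  (* By [th] and [xe], [2 * (1 - e) <= x * (1 + e) <= (1 + e) ^+ 2]. *)
  have quad : 0 <= e ^+ 2 + 4 * e - 1 by nra.
  pose k := 2 * (1 - e) / (1 + e).
  have k0 : 0 <= k by apply: divr_ge0; lra.
  have kx : k <= x by rewrite ler_pdivrMr; lra.
  have kk : (1 - e) * (1 + e) * (1 - e - e * k) <= 2 * e * (k ^+ 2 - (1 - e) ^+ 2).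
    rewrite -subr_ge0 (_ : _ - _ =
        ((1 - e) / (1 + e)) ^+ 2 * (1 - e) * (e ^+ 2 + 4 * e - 1)).
      by apply: mulr_ge0 => //; apply: mulr_ge0; [exact: sqr_ge0|lra].
    by rewrite /k; field; rewrite gt_eqF//; lra.
  have : 0 <= (1 - e) * (1 + e) * e * (x - k) by rewrite !mulr_ge0//; lra.
  have : 0 <= 2 * e * (x - k) * (x + k) by rewrite !mulr_ge0//; lra.
  nra.
have c1 : 0 <= (1 - e) / (1 + e) by apply: divr_ge0; lra.
have c2 : 0 <= 2 * e / (1 + e) ^+ 2 by apply: divr_ge0; [lra|exact: sqr_ge0].
have c3 : (e * x - (1 - e)) / x ^+ 2 <= 0.
  by rewrite ler_pdivrMr ?exprn_gt0// mul0r; lra.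
have m1 := ler_wnM2l c3 h2.
have m2 := ler_wpM2l c1 m1.
have m3 := ler_wpM2r c2 h1.
apply: (le_trans _ (lerD m2 m3)).
rewrite [X in _ <= X](_ : _ =
    2 * (2 * e * (x ^+ 2 - (1 - e) ^+ 2) - (1 - e) * (1 + e) * (1 - e - e * x)) /
    ((1 + e) ^+ 2 * x * (x - (1 - e)))).
  apply: divr_ge0; first by lra.
  by rewrite !mulr_ge0 ?sqr_ge0//; lra.
by rewrite /y; field; rewrite !gt_eqF//; lra.
Qed.

(** The equation [z = 1 + expR (- z)] describes the corner [1 + t = 2 * u], where the upper curve
    meets [t = expR (- (2 * u))], whose slope is constantly 2. *)
Lemma slope_up_corner : exists z : R,
  [/\ 0 < z, z = 1 + expR (- z) & slope_up z (expR (- z)) = 2].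
Proof.
have [|||z _ ze] := @IVT R (fun x => x - expR (- x)) 0 2 1; first by lra.
- apply: derivable_within_continuous => x _.
  have [] // := derive_add (derive_id x)
    (derive_opp (derive_comp (is_derive_expR (- x)) (derive_opp (derive_id x)))).
- have [_ h _ _] := @expRN_bounds 2 ltac:(lra).
  rewrite oppr0 expR0 ge_min le_max; apply/andP; split; apply/orP; [left|right]; lra.
have zE : z = 1 + expR (- z) by lra.
have e0 := expR_gt0 (- z).
have z0 : 0 < z by lra.
exists z; split => //; rewrite /slope_up -zE.
rewrite (_ : z + _ = 2); last by lra.
rewrite (_ : z - _ = 2 * expR (- z)); last by lra.
rewrite (_ : 2 / (2 * _) = (expR (- z))^-1); last by field; rewrite expR_eq0.
by rewrite -expRN opprK expRK; field; rewrite gt_eqF.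
Qed.

End Boundary_slopes.

(** * Closure of S in the coordinates u and t *)

Section Gluing_coordinates.
Context {R : realType}.
Implicit Types u t z E x y : R.

(** For comparison with the boundary point of the same [z]: both factors of [slope_up] decrease in
    [E]. *)
Lemma slope_up_lt z E E' : 0 <= E -> E < E' -> E' <= 1 -> 0 < z - (1 - E) ->
  slope_up z E' < slope_up z E.
Proof.
move=> E0 EE E1 zE; rewrite /slope_up; apply: ltr_pM.
- by apply: ln_ge0; rewrite ler_pdivlMr; lra.
- by apply: divr_ge0; lra.
- have d0 : 0 < z - (1 - E') by lra.
  have n0 : 0 < z + (1 - E) by lra.
  have n0' : 0 < z + (1 - E') by lra.
  rewrite ltr_ln ?posrE; [|exact: divr_gt0|exact: divr_gt0].
  rewrite ltr_pdivrMr// mulrAC ltr_pdivlMr//.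
  have : 0 < z * (E' - E) by rewrite mulr_gt0; lra.
  by lra.
- rewrite ltr_pdivrMr; last by lra.
  rewrite mulrAC ltr_pdivlMr; last by lra.
  have : 0 < (z + 2) * (E' - E) by rewrite mulr_gt0; lra.
  by lra.
Qed.

(** For comparison with the boundary point of the same [E]: both factors of [slope_low] increase in
    [z]. *)
Lemma slope_low_lt z z' E : 0 <= E < 1 -> 0 <= z -> z < z' -> z' < 1 + E ->
  slope_low z E < slope_low z' E.
Proof.
move=> /andP[E0 E1] z0 zz zE; rewrite /slope_low; apply: ltr_pM.
- by apply: ln_ge0; rewrite ler_pdivlMr; lra.
- by apply: divr_ge0; lra.
- have d0 : 0 < 1 + E - z by lra.
  have d0' : 0 < 1 + E - z' by lra.
  have n0 : 0 < 1 + E + z by lra.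
  have n0' : 0 < 1 + E + z' by lra.
  rewrite ltr_ln ?posrE; [|exact: divr_gt0|exact: divr_gt0].
  rewrite ltr_pdivrMr// mulrAC ltr_pdivlMr//.
  have : 0 < (1 + E) * (z' - z) by rewrite mulr_gt0; lra.
  by lra.
- by rewrite ltr_pM2r ?invr_gt0; lra.
Qed.

(* Homogeneous form of [z >= f_bound y]; see [f_bound_tri]. *)
Definition tri x y z := x - z <= (x + z) * expR (- (2 * y / (x + z))).

(** This form uses the two arguments of the slopes, [2 * y / (x + z)] and [(x - z) / (x + z)]. *)
Lemma triE x y z : 0 < x + z ->
  tri x y z <-> (x - z) / (x + z) <= expR (- (2 * y / (x + z))).
Proof. by move=> h; rewrite /tri ler_pdivrMr// [leRHS]mulrC. Qed.

(* The triple [(a, b, c)] is proportional to [(2 * u, 1 + t, 1 - t)], where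
   [b >= c].  In the second case of [upper], [a] is the
   largest entry. *)
Definition upper u t :=
  t <= expR (- (2 * u)) \/ 1 + t <= 2 * u /\ tri (2 * u) (1 + t) (1 - t).

Definition lower u t := tri (1 + t) (1 - t) (2 * u).

Lemma slope_upE u t : 0 < u -> 0 < t <= 1 ->
  slope_up (2 * (1 + t) / (2 * u + (1 - t)))
    ((2 * u - (1 - t)) / (2 * u + (1 - t))) = - ln t / u.
Proof.
move=> u0 /andP[t0 t1]; rewrite /slope_up.
set D := 2 * u + (1 - t).
have D0 : D != 0 by rewrite gt_eqF// /D; lra.
have t'0 : t != 0 by rewrite gt_eqF.
have u'0 : u != 0 by rewrite gt_eqF.
rewrite (_ : _ / D + _ = 4 / D); last by rewrite /D; field.
rewrite (_ : _ / D - _ = 4 * t / D); last by rewrite /D; field.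
rewrite (_ : 1 + _ / D = 4 * u / D); last by rewrite /D; field.
rewrite (_ : 4 / D / (4 * t / D) = t^-1); last by field; rewrite ?D0 ?t'0.
by rewrite lnV ?posrE//; field; rewrite ?D0 ?u'0.
Qed.

Lemma slope_lowE u t : 0 < u -> 0 < t <= 1 ->
  slope_low (2 * (1 - t) / (1 + t + 2 * u))
    ((1 + t - 2 * u) / (1 + t + 2 * u)) = - ln t / u.
Proof.
move=> u0 /andP[t0 t1]; rewrite /slope_low.
set D := 1 + t + 2 * u.
have D0 : D != 0 by rewrite gt_eqF// /D; lra.
have t'0 : t != 0 by rewrite gt_eqF.
have u'0 : u != 0 by rewrite gt_eqF.
rewrite (_ : 1 + _ / D + _ = 4 / D); last by rewrite /D; field.
rewrite (_ : 1 + _ / D - 2 * _ / D = 4 * t / D); last by rewrite /D; field.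
rewrite (_ : 1 - _ / D = 4 * u / D); last by rewrite /D; field.
rewrite (_ : 4 / D / (4 * t / D) = t^-1); last by field; rewrite ?D0 ?t'0.
by rewrite lnV ?posrE//; field; rewrite ?D0 ?u'0.
Qed.

Lemma ln_slope_ge2 u t : 0 < u -> 0 < t ->
  (2 <= - ln t / u) = (t <= expR (- (2 * u))).
Proof.
by move=> u0 t0; rewrite -[in RHS](lnK (x := t)) ?posrE// ler_expR
  ler_pdivlMr// lerNr.
Qed.

(* If [tri] failed at the second point, its slope would be less than that of the
   boundary point with the same [z], hence than that of the first point. *)
Lemma tri_up_scale u t u' t' : 1 + t <= 2 * u -> t <= 1 -> u <= u' ->
    0 < t' -> t' <= t -> - ln t / u <= - ln t' / u' ->
  tri (2 * u) (1 + t) (1 - t) -> tri (2 * u') (1 + t') (1 - t').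
Proof.
move=> ut t1 uu t'0 tt sl.
have u0 : 0 < u by lra.
have u'0 : 0 < u' by lra.
have D0 : 0 < 2 * u + (1 - t) by lra.
have D'0 : 0 < 2 * u' + (1 - t') by lra.
move=> /(triE _ D0) h; apply/(triE _ D'0); rewrite leNgt; apply/negP => h'.
move: sl; rewrite -!slope_upE//; try lra.
set z := 2 * (1 + t) / _ in h *; set z' := 2 * (1 + t') / _ in h' *.
set E := (2 * u - _) / _ in h *; set E' := (2 * u' - _) / _ in h' *.
have z'0 : 0 < z' by rewrite divr_gt0//; lra.
have zz : z' <= z.
  by apply: ler_pM; rewrite ?invr_ge0 ?lef_pV2 ?posrE; lra.
have z0 : 0 < z by exact: lt_le_trans zz.
have zE : z <= 1 + E.
  rewrite (_ : 1 + E = 4 * u / (2 * u + (1 - t))); last first.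
    by rewrite /E; field; rewrite gt_eqF.
  by rewrite ler_pM2r ?invr_gt0//; lra.
have E1 : E <= 1 by rewrite ler_pdivrMr; lra.
have E0 : 0 <= E by rewrite divr_ge0; lra.
have E'1 : E' <= 1 by rewrite ler_pdivrMr; lra.
have [e0 e1 ez _] := expRN_bounds z0.
have [e'0 e'1 ez' _] := expRN_bounds z'0.
have s1 : slope_up z' (expR (- z')) <= slope_up z (expR (- z)).
  by apply: slope_up_mono => //; lra.
have s2 : slope_up z' E' < slope_up z' (expR (- z')).
  by apply: slope_up_lt; lra.
have s3 : slope_up z (expR (- z)) <= slope_up z E.
  move: h; rewrite le_eqVlt => /orP[/eqP <-//|h].
  apply/ltW/slope_up_lt => //; first exact: ltW.
  rewrite (_ : z - _ = 4 * t / (2 * u + (1 - t))); first by rewrite divr_gt0//; lra.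
  by rewrite /z /E; field; rewrite gt_eqF.
by move=> s4; have := lt_le_trans (le_lt_trans s4 s2) (le_trans s1 s3); rewrite ltxx.
Qed.

(* As for [tri_up_scale], with boundary points that have the same [E]. *)
Lemma lower_scale u t u' t' : 0 < u -> u <= u' -> 0 < t' -> t' <= t -> t <= 1 ->
  - ln t' / u' <= - ln t / u -> lower u t -> lower u' t'.
Proof.
move=> u0 uu t'0 tt t1 sl.
have u'0 : 0 < u' by lra.
have D0 : 0 < 1 + t + 2 * u by lra.
have D'0 : 0 < 1 + t' + 2 * u' by lra.
move=> /(triE _ D0) h; apply/(triE _ D'0); rewrite leNgt; apply/negP => h'.
move: sl; rewrite -!slope_lowE//; try lra.
set z := 2 * (1 - t) / _ in h *; set z' := 2 * (1 - t') / _ in h' *.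
set E := (1 + t - _) / _ in h *; set E' := (1 + t' - _) / _ in h' *.
have EE : E' <= E.
  rewrite ler_pdivrMr// mulrAC ler_pdivlMr//.
  have : 0 <= u' * t - u * t' by rewrite subr_ge0 ler_pM//; lra.
  by lra.
have E'0 : 0 < E' by apply: lt_trans h'; exact: expR_gt0.
have E0 : 0 < E by lra.
have E1 : E < 1 by rewrite ltr_pdivrMr; lra.
have z'E : z' < 1 + E'.
  rewrite -subr_gt0 (_ : 1 + E' - z' = 4 * t' / (1 + t' + 2 * u')).
    by rewrite divr_gt0//; lra.
  by rewrite /E' /z'; field; rewrite gt_eqF.
have zZ : z <= - ln E by rewrite lerNr -ler_expR lnK ?posrE.
have zZ' : - ln E' < z' by rewrite ltrNl -ltr_expR lnK ?posrE.
have ZZ : - ln E <= - ln E' by rewrite lerN2 ler_ln ?posrE.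
have Z0 : 0 < - ln E by rewrite oppr_gt0 ln_lt0// E0.
have z0 : 0 <= z by rewrite divr_ge0//; lra.
have s1 : slope_low (- ln E) E <= slope_low (- ln E') E'.
  have := slope_low_mono Z0 ZZ; rewrite !opprK !lnK ?posrE//; apply; lra.
have s2 : slope_low (- ln E') E' < slope_low z' E'.
  by apply: slope_low_lt; lra.
have s3 : slope_low z E <= slope_low (- ln E) E.
  move: zZ; rewrite le_eqVlt => /orP[/eqP <-//|zZ].
  by apply/ltW/slope_low_lt; lra.
by move=> s4; have := lt_le_trans s2 (le_trans s4 (le_trans s3 s1)); rewrite ltxx.
Qed.

(** If [tri] failed, the slope would be less than that of the boundary point with the same [z]. Up
    to the corner [w] the latter is at most 2, whereas [t <= expR (- (2 * u))] makes the slope at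
    least 2. Beyond [w], [expR (- z) < t] gives [2 * u < z], against [z <= 1 + t <= 2 * u]. *)
Lemma upper_tri u t : 0 <= t <= 1 -> 1 + t <= 2 * u -> upper u t ->
  tri (2 * u) (1 + t) (1 - t).
Proof.
move=> /andP[t0 t1] ut [tu|[//]].
have u0 : 0 < u by lra.
have D0 : 0 < 2 * u + (1 - t) by lra.
apply/(triE _ D0).
(* At [t = 0] there is no slope, but the claim reads [1 - z <= expR (- z)] with
   [z = 2 / (2 * u + 1)]. *)
have [t00|tn0] := eqVneq t 0.
  apply: le_trans (expR_ge1Dx _); rewrite t00 le_eqVlt; apply/orP; left.
  by apply/eqP; field; rewrite gt_eqF//; lra.
have {}t0 : 0 < t by rewrite lt_neqAle eq_sym tn0.
rewrite leNgt; apply/negP => h.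
have := slope_upE u0; move=> /(_ t); rewrite t0 t1 => /(_ isT).
move: tu (tu); rewrite -{1}ln_slope_ge2// => sl tu.
set z := 2 * (1 + t) / _ in h *; set E := (2 * u - _) / _ in h *.
move=> slE.
have z0 : 0 < z by rewrite divr_gt0//; lra.
have [e0 e1 ez _] := expRN_bounds z0.
have E1 : E <= 1 by rewrite ler_pdivrMr; lra.
have s2 : slope_up z E < slope_up z (expR (- z)).
  by apply: slope_up_lt; lra.
have [w [w0 wE sw]] := @slope_up_corner R.
have [zw|wz] := leP z w.
  have := slope_up_mono z0 zw; rewrite sw -wE lexx => /(_ isT) s1.
  lra.
have zt : z <= 1 + t.
  rewrite ler_pdivrMr// mulrC ler_wpM2l//; lra.
have et : expR (- z) < t.
  have D1 : 0 < z + (1 - E) by lra.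
  have -> : t = (z - (1 - E)) / (z + (1 - E)).
    by rewrite /z /E; field; rewrite gt_eqF//= gt_eqF//; lra.
  rewrite ltr_pdivlMr//.
  have ew : expR (- z) < expR (- w) by rewrite ltr_expR ltrN2.
  set e := expR (- z) in h ez e0 e1 ew *.
  (* Beyond the corner, [z > w = 1 + expR (- w) > 1 + e]. *)
  have : 0 <= (1 - e) * (z - 1 - e) by rewrite mulr_ge0; lra.
  have : 0 < (1 + e) * (E - e) by rewrite mulr_gt0; lra.
  lra.
by have := lt_le_trans et tu; rewrite ltr_expR ltrN2; lra.
Qed.

Lemma upper_scale u t u' t' : 0 < u -> u <= u' -> 0 < t' -> t' <= t -> t <= 1 ->
  - ln t / u <= - ln t' / u' -> upper u t -> upper u' t'.
Proof.
move=> u0 uu t'0 tt t1 sl [h|[h1 h2]]; [left|right].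
  by rewrite -ln_slope_ge2 ?(le_trans _ sl) ?ln_slope_ge2//; lra.
by split; [lra|apply: (tri_up_scale (u := u) (t := t))].
Qed.

(** The slope [- ln (t * t') / (u + u')] of the glue is the mediant of the slopes of its parts. *)
Lemma mediant_le (a b c d : R) : 0 < b -> 0 < d ->
  a / b <= c / d -> a / b <= (a + c) / (b + d) <= c / d.
Proof.
move=> b0 d0; rewrite ler_pdivrMr// mulrAC ler_pdivlMr// => h.
have bd0 : 0 < b + d by rewrite addr_gt0.
by rewrite !ler_pdivlMr// mulrAC ler_pdivrMr// mulrAC ler_pdivrMr//; lra.
Qed.

Lemma ln_mul_neg t t' : 0 < t -> 0 < t' -> - ln (t * t') = - ln t + - ln t'.
Proof. by move=> t0 t'0; rewrite lnM ?posrE// opprD. Qed.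

(** The slope of the glue is at least the smaller of the two slopes, so [upper_scale] starts from
    the part with the smaller one. Points with [t = 0] or [u = 0] have no slope and are treated
    first. *)
Lemma upper_glue u t u' t' : 0 <= u -> 0 <= u' -> 0 <= t <= 1 -> 0 <= t' <= 1 ->
  upper u t -> upper u' t' -> upper (u + u') (t * t').
Proof.
move=> u0 u'0 /andP[t0 t1] /andP[t'0 t'1] U U'.
have [te|tn] := eqVneq t 0; first by left; rewrite te mul0r expR_ge0.
have [te|t'n] := eqVneq t' 0; first by left; rewrite te mulr0 expR_ge0.
have {}t0 : 0 < t by rewrite lt0r tn.
have {}t'0 : 0 < t' by rewrite lt0r t'n.
have tt0 : 0 < t * t' by rewrite mulr_gt0.
have ttt : t * t' <= t by rewrite ler_piMr// ltW.
have ttt' : t * t' <= t' by rewrite ler_piMl// ltW.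
have lnt : 0 <= - ln t by rewrite oppr_ge0 ln_le0.
have lnt' : 0 <= - ln t' by rewrite oppr_ge0 ln_le0.
have [ue|un] := eqVneq u 0; have [ue'|u'n] := eqVneq u' 0.
- by left; rewrite ue ue' addr0 mulr0 oppr0 expR0; lra.
- have {}u'0 : 0 < u' by rewrite lt0r u'n.
  rewrite ue add0r; apply: (upper_scale (u := u') (t := t')) => //.
  by rewrite ler_pM2r ?invr_gt0// ln_mul_neg// lerDr.
- have {}u0 : 0 < u by rewrite lt0r un.
  rewrite ue' addr0; apply: (upper_scale (u := u) (t := t)) => //.
  by rewrite ler_pM2r ?invr_gt0// ln_mul_neg// lerDl.
have {}u0 : 0 < u by rewrite lt0r un.
have {}u'0 : 0 < u' by rewrite lt0r u'n.
have [h|/ltW h] := leP (- ln t / u) (- ln t' / u').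
  apply: (upper_scale (u := u) (t := t)) => //; first by lra.
  by rewrite ln_mul_neg//; have /andP[] := mediant_le u0 u'0 h.
apply: (upper_scale (u := u') (t := t')) => //; first by lra.
by rewrite ln_mul_neg// addrC (addrC u); have /andP[] := mediant_le u'0 u0 h.
Qed.

Lemma lower0 t : 0 <= t <= 1 -> lower 0 t -> t = 1.
Proof.
move=> /andP[t0 t1] h; apply/eqP; rewrite eq_le t1 /= leNgt; apply/negP => tl.
move: h; rewrite /lower /tri mulr0 addr0 subr0 -[leLHS]mulr1 ler_pM2l; last by lra.
rewrite leNgt => /negP; apply; rewrite expR_lt1 oppr_lt0 divr_gt0//; lra.
Qed.

(** Without a slope at [t = 0], monotonicity is direct: [(1 - 2 * u) / (1 + 2 * u)] decreases in [u]
    and [expR (- (2 / (1 + 2 * u)))] increases. *)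
Lemma lower_t0 u u' : 0 <= u -> u <= u' -> lower u 0 -> lower u' 0.
Proof.
move=> u0 uu; rewrite /lower addr0 subr0.
have D0 : 0 < 1 + 2 * u by lra.
have D'0 : 0 < 1 + 2 * u' by lra.
move=> /(triE _ D0) h; apply/(triE _ D'0).
have i : (1 + 2 * u')^-1 <= (1 + 2 * u)^-1 by rewrite lef_pV2 ?posrE//; lra.
apply: le_trans (le_trans h _).
  by rewrite ler_pdivrMr// mulrAC ler_pdivlMr//; lra.
by rewrite ler_expR lerN2 ler_wpM2l//; lra.
Qed.

(** Dual to [upper_glue], starting from the part with the larger slope. A part with [u = 0] has
    [t = 1] by [lower0], so it is neutral. *)
Lemma lower_glue u t u' t' : 0 <= u -> 0 <= u' -> 0 <= t <= 1 -> 0 <= t' <= 1 ->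
  lower u t -> lower u' t' -> lower (u + u') (t * t').
Proof.
move=> u0 u'0 /andP[t0 t1] /andP[t'0 t'1] L L'.
have [te|tn] := eqVneq t 0.
  by move: L; rewrite te mul0r; apply: lower_t0 => //; lra.
have [te|t'n] := eqVneq t' 0.
  by move: L'; rewrite te mulr0; apply: lower_t0 => //; lra.
have [ue|un] := eqVneq u 0.
  by move: L; rewrite ue => /(lower0 (t := t)) ->; rewrite ?t0// add0r mul1r.
have [ue|u'n] := eqVneq u' 0.
  by move: L'; rewrite ue => /(lower0 (t := t')) ->; rewrite ?t'0// addr0 mulr1.
have {}u0 : 0 < u by rewrite lt0r un.
have {}u'0 : 0 < u' by rewrite lt0r u'n.
have {}t0 : 0 < t by rewrite lt0r tn.
have {}t'0 : 0 < t' by rewrite lt0r t'n.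
have tt0 : 0 < t * t' by rewrite mulr_gt0.
have [h|/ltW h] := leP (- ln t / u) (- ln t' / u').
  apply: (lower_scale (u := u') (t := t')) => //; [lra|by rewrite ler_piMl//ltW|].
  by rewrite ln_mul_neg//; have /andP[] := mediant_le u0 u'0 h.
apply: (lower_scale (u := u) (t := t)) => //; [lra|by rewrite ler_piMr//ltW|].
by rewrite ln_mul_neg// addrC (addrC u); have /andP[] := mediant_le u'0 u0 h.
Qed.

(** * The set S in terms of sorted triples *)

Lemma tri_scale k x y z : 0 < k -> tri (k * x) (k * y) (k * z) <-> tri x y z.
Proof.
move=> k0; rewrite /tri -mulrBr -mulrDr -mulrA ler_pM2l//.
by rewrite mulrCA invfM mulrACA mulfV ?gt_eqF// mul1r.
Qed.

Definition sorted_S x y z := [/\ x >= y /\ y >= z /\ z >= 0, x + y + z = 1 & tri x y z].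

(** As [1 - y = x + z], doubling the inequality and rearranging suffices. *)
Lemma f_bound_tri x y z : 0 < x + z -> x + y + z = 1 ->
  (z >= f_bound y) = (x - z <= (x + z) * expR (- (2 * y / (x + z)))).
Proof.
move=> h s; rewrite /f_bound (_ : 1 - y = x + z); last by lra.
rewrite (_ : y - 1 = - (x + z)); last by lra.
by rewrite invrN mulrN; apply/idP/idP; lra.
Qed.

Lemma in_S_perm s (v : 'cV[R]_3) : in_S v -> in_S (perm_mx s *m v).
Proof.
move=> [P [a [b [c [/is_perm_mxP[r ->] -> h1 h2 h3]]]]].
exists (perm_mx (s * r)), a, b, c; split => //; last by rewrite mulmxA perm_mxM.
by apply/is_perm_mxP; exists (s * r)%g.
Qed.

Lemma in_S_swap12 (a b c : R) : in_S (vec3 a b c) -> in_S (vec3 b a c).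
Proof.
move=> /(in_S_perm (tperm 0 1)); congr in_S; rewrite -row_permE.
apply/matrixP => i j; rewrite !mxE permE /=.
by case: i => [[|[|[|?]]] ?].
Qed.

Lemma in_S_swap23 (a b c : R) : in_S (vec3 a b c) -> in_S (vec3 a c b).
Proof.
move=> /(in_S_perm (tperm 1 2)); congr in_S; rewrite -row_permE.
apply/matrixP => i j; rewrite !mxE permE /=.
by case: i => [[|[|[|?]]] ?].
Qed.

Lemma sorted_in_S (x y z : R) : sorted_S x y z -> in_S (vec3 x y z).
Proof.
move=> [[xy [yz z0]] s h]; exists 1%:M, x, y, z; split => //.
- by apply/is_perm_mxP; exists 1%g; rewrite perm_mx1.
- by rewrite mul1mx.
- by rewrite (f_bound_tri (x := x)) //; lra.
Qed.

Lemma in_S_sorted (a b c : R) : in_S (vec3 a b c) ->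
  (sorted_S a b c \/ sorted_S a c b) \/ (sorted_S b a c \/ sorted_S b c a) \/
  (sorted_S c a b \/ sorted_S c b a).
Proof.
move=> [P [x [y [z [/is_perm_mxP[s ->] e [xy [yz z0]] sum]]]]].
rewrite (f_bound_tri (x := x)) => // [h|]; last by lra.
have {}h : sorted_S x y z by split.
have E i : vec3 a b c i 0 = vec3 x y z (s i) 0.
  by rewrite e -row_permE !mxE.
have := E 0; have := E 1; have := E 2%:R; rewrite !mxE /=.
have n01 : s 0 != s 1 by rewrite (inj_eq perm_inj).
have n02 : s 0 != s 2%:R by rewrite (inj_eq perm_inj).
have n12 : s 1 != s 2%:R by rewrite (inj_eq perm_inj).
move: n01 n02 n12.
case: (s 0) => [[|[|[|?]]] ?]; case: (s 1) => [[|[|[|?]]] ?];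
case: (s 2%:R) => [[|[|[|?]]] ?] //= _ _ _ -> -> ->; tauto.
Qed.

End Gluing_coordinates.

(** * Passing between S and the coordinates u and t *)

Section Closure.
Context {R : realType}.
Implicit Types u t a b c k : R.

Lemma in_S_cases a b c : c <= b -> in_S (vec3 a b c) ->
  [\/ sorted_S a b c, sorted_S b a c | sorted_S b c a].
Proof.
move=> cb /in_S_sorted [[h|h]|[[h|h]|[h|h]]]; first by constructor 1.
- have e : b = c by case: h => -[? [? ?]] _ _; lra.
  by subst b; constructor 1.
- by constructor 2.
- by constructor 3.
- have e : b = c by case: h => -[? [? ?]] _ _; lra.
  by subst b; constructor 2.
- have e : b = c by case: h => -[? [? ?]] _ _; lra.
  by subst b; constructor 3.
Qed.

Lemma in_S_simplex a b c : in_S (vec3 a b c) ->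
  [/\ 0 <= a, 0 <= b, 0 <= c & a + b + c = 1].
Proof.
by move=> /in_S_sorted [[h|h]|[[h|h]|[h|h]]]; case: h => -[? [? ?]] ? _; split; lra.
Qed.

(** The lower bound is automatic unless [a] is the smallest entry, by [1 - x <= expR (- x)]. *)
Lemma lower_ge u t : 0 <= t <= 1 -> 1 - t <= 2 * u -> lower u t.
Proof.
move=> /andP[t0 t1] tu; have D0 : 0 < 1 + t + 2 * u by lra.
apply/(triE _ D0); apply: le_trans (expR_ge1Dx _).
have -> : 1 + - (2 * (1 - t) / (1 + t + 2 * u)) =
          (1 + t + 2 * u - 2 * (1 - t)) / (1 + t + 2 * u).
  by field; rewrite gt_eqF.
by rewrite ler_pM2r ?invr_gt0//; lra.
Qed.

Lemma upper_le u t : 2 * u <= 1 - t -> upper u t.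
Proof. by move=> tu; left; apply: le_trans (expR_ge1Dx _); lra. Qed.

(** With [a] in the middle, the boundary of S is the curve [t = expR (- (2 * u))]. *)
Lemma tri_mid u t : tri (1 + t) (2 * u) (1 - t) <-> t <= expR (- (2 * u)).
Proof.
rewrite /tri (_ : 1 + t + (1 - t) = 2); last by ring.
rewrite (_ : 2 * (2 * u) / 2 = 2 * u); last by field.
by rewrite (_ : 1 + t - (1 - t) = 2 * t) ?ler_pM2l//; ring.
Qed.

Lemma in_S_coords k u t : 0 < k -> 0 <= u -> 0 <= t <= 1 ->
  in_S (vec3 (k * (2 * u)) (k * (1 + t)) (k * (1 - t))) ->
  upper u t /\ lower u t.
Proof.
move=> k0 u0 t01; have /andP[t0 t1] := t01.
have cb : k * (1 - t) <= k * (1 + t) by rewrite ler_pM2l//; lra.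
case/(in_S_cases cb) => -[[]]; rewrite !ler_pM2l// => h1 [h2 _] _ /(tri_scale _ _ _ k0) h.
- by split; [right|apply: lower_ge => //; lra].
- by split; [left; exact/tri_mid|apply: lower_ge].
- by split; [exact: upper_le|].
Qed.

(** The factor [k] makes the entries sum to 1. The condition of S comes from [upper] when [a] is the
    largest or the middle entry, and from [lower] when it is the smallest. *)
Lemma coords_in_S u t : 0 <= u -> 0 <= t <= 1 -> upper u t -> lower u t ->
  let k := (2 * (1 + u))^-1 in
  in_S (vec3 (k * (2 * u)) (k * (1 + t)) (k * (1 - t))).
Proof.
move=> u0 t01 U L k; have /andP[t0 t1] := t01.
have k0 : 0 < k by rewrite invr_gt0; lra.
have sum : k * (2 * u) + k * (1 + t) + k * (1 - t) = 1.
  by rewrite /k; field; rewrite gt_eqF//; lra.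
have [h1|/ltW h1] := leP (1 + t) (2 * u).
  apply: sorted_in_S; split => //; last by apply/(tri_scale _ _ _ k0); exact: upper_tri.
  by rewrite !ler_pM2l// mulr_ge0//; lra.
have [h2|/ltW h2] := leP (1 - t) (2 * u).
  apply/in_S_swap12/sorted_in_S; split.
  - by rewrite !ler_pM2l// mulr_ge0//; lra.
  - by move: sum; lra.
  (* In the second case of [upper], [1 + t <= 2 * u] becomes an equality, and the two largest
     entries coincide. *)
  apply/(tri_scale _ _ _ k0)/tri_mid; case: U => // -[h3 h].
  apply/tri_mid; rewrite (_ : 2 * u = 1 + t) in h *; last by lra.
  exact: h.
apply/in_S_swap12/in_S_swap23/sorted_in_S; split.
- by rewrite !ler_pM2l// mulr_ge0//; lra.
- by move: sum; lra.
exact/(tri_scale _ _ _ k0).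
Qed.

Lemma in_S_vertex : in_S (vec3 1 0 0 : 'cV[R]_3).
Proof.
apply: sorted_in_S; split; [lra|lra|].
by rewrite /tri subr0 addr0 mulr0 mul0r oppr0 expR0 mulr1.
Qed.

Lemma in_S_coordsP a b c : in_S (vec3 a b c) -> c <= b -> a != 1 ->
  let u := a / (b + c) in let t := (b - c) / (b + c) in
  [/\ 0 < b + c, 0 <= u, 0 <= t <= 1, upper u t & lower u t].
Proof.
move=> S cb an u t; have [a0 b0 c0 sum] := in_S_simplex S.
have s0 : 0 < b + c.
  by rewrite lt0r addr_ge0// andbT; apply: contraNneq an => s0; apply/eqP; lra.
have u0 : 0 <= u by rewrite divr_ge0// ltW.
have t01 : 0 <= t <= 1.
  by rewrite divr_ge0 ?ler_pdivrMr//; lra.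
have s2 : 0 < (b + c) / 2 by lra.
have sn : b + c != 0 by rewrite gt_eqF.
have [|U L] := @in_S_coords ((b + c) / 2) u t s2 u0 t01; last by split.
by move: S; congr (in_S (vec3 _ _ _)); rewrite /u /t; field.
Qed.

Lemma in_S_glue_sorted (a1 b1 c1 a2 b2 c2 : R) : c1 <= b1 -> c2 <= b2 ->
  in_S (vec3 a1 b1 c1) -> in_S (vec3 a2 b2 c2) -> a1 * a2 != 1 ->
  in_S (vec3 ((a1 * b2 + a1 * c2 + b1 * a2 + c1 * a2) / (1 - a1 * a2))
             ((b1 * c2 + c1 * b2) / (1 - a1 * a2))
             ((b1 * b2 + c1 * c2) / (1 - a1 * a2))).
Proof.
move=> bc1 bc2 S1 S2 an.
have [x1 y1 z1 sum1] := in_S_simplex S1.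
have [x2 y2 z2 sum2] := in_S_simplex S2.
have dn : 1 - a1 * a2 != 0 by rewrite subr_eq0 eq_sym.
(* A part with [a1 = 1] has [b1 + c1 = 0] and no coordinates; the result is then the vertex
   [(1, 0, 0)]. *)
have [e1|n1] := eqVneq a1 1.
  have [b0 c0] : b1 = 0 /\ c1 = 0 by lra.
  have a2n : 1 - a2 != 0 by move: dn; rewrite e1 mul1r.
  have := in_S_vertex; congr (in_S (vec3 _ _ _)); rewrite b0 c0 e1 ?mul1r; last 2 first.
  - by rewrite !mul0r addr0 mul0r.
  - by rewrite !mul0r addr0 mul0r.
  rewrite (_ : b2 + c2 + 0 * a2 + 0 * a2 = 1 - a2) ?divff//; lra.
have [e2|n2] := eqVneq a2 1.
  have [b0 c0] : b2 = 0 /\ c2 = 0 by lra.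
  have a1n : 1 - a1 != 0 by move: dn; rewrite e2 mulr1.
  have := in_S_vertex; congr (in_S (vec3 _ _ _)); rewrite b0 c0 e2 ?mulr1; last 2 first.
  - by rewrite !mulr0 addr0 mul0r.
  - by rewrite !mulr0 addr0 mul0r.
  rewrite (_ : a1 * 0 + a1 * 0 + b1 + c1 = 1 - a1) ?divff//; lra.
have [s1 u1 t1 U1 L1] := in_S_coordsP S1 bc1 n1.
have [s2 u2 t2 U2 L2] := in_S_coordsP S2 bc2 n2.
have t3 : 0 <= (b1 - c1) / (b1 + c1) * ((b2 - c2) / (b2 + c2)) <= 1.
  case/andP: t1 => ? ?; case/andP: t2 => ? ?; apply/andP.
  by split; [exact: mulr_ge0|exact: mulr_ile1].
have := coords_in_S (addr_ge0 u1 u2) t3 (upper_glue u1 u2 t1 t2 U1 U2)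
  (lower_glue u1 u2 t1 t2 L1 L2).
(* The product of the two [t] is a multiple of [(b1 * b2 + c1 * c2) - (b1 * c2 + c1 * b2)], so the
   last entry is the larger one and the two have to be exchanged. *)
move=> /in_S_swap23.
have {}s1 : b1 + c1 != 0 by rewrite gt_eqF.
have {}s2 : b2 + c2 != 0 by rewrite gt_eqF.
have E1 : a1 = 1 - (b1 + c1) by lra.
have E2 : a2 = 1 - (b2 + c2) by lra.
have dn' : b1 + c1 + (b2 + c2) - (b1 + c1) * (b2 + c2) != 0.
  by apply: contraNneq dn => e; apply/eqP; rewrite E1 E2 -e; ring.
have kE : (2 * (1 + (a1 / (b1 + c1) + a2 / (b2 + c2))))^-1 =
    (b1 + c1) * (b2 + c2) / (2 * (1 - a1 * a2)).
  by rewrite -[RHS]invf_div; congr (_^-1); rewrite E1 E2; field; rewrite s1 s2.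
rewrite kE; congr (in_S (vec3 _ _ _)); field; by rewrite ?s1 ?s2 ?dn.
Qed.

Lemma in_S_glue (a1 b1 c1 a2 b2 c2 : R) :
  in_S (vec3 a1 b1 c1) -> in_S (vec3 a2 b2 c2) -> a1 * a2 != 1 ->
  in_S (vec3 ((a1 * b2 + a1 * c2 + b1 * a2 + c1 * a2) / (1 - a1 * a2))
             ((b1 * c2 + c1 * b2) / (1 - a1 * a2))
             ((b1 * b2 + c1 * c2) / (1 - a1 * a2))).
Proof.
(* Exchanging [b1] and [c1] exchanges the last two entries of the result. *)
wlog bc1 : b1 c1 / c1 <= b1.
  move=> wl S1 S2 an; have [h|/ltW h] := leP c1 b1; first exact: wl.
  have := in_S_swap23 (wl _ _ h (in_S_swap23 S1) S2 an).
  by congr (in_S (vec3 _ _ _)); congr (_ / _); ring.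
wlog bc2 : b2 c2 / c2 <= b2.
  move=> wl S1 S2 an; have [h|/ltW h] := leP c2 b2; first exact: wl.
  have := in_S_swap23 (wl _ _ h S1 (in_S_swap23 S2) an).
  by congr (in_S (vec3 _ _ _)); congr (_ / _); ring.
exact: in_S_glue_sorted.
Qed.

End Closure.

Theorem theorem7 (R : realType) (G1 G2 : gadget)
    (a1 b1 c1 a2 b2 c2 : R)
    (sig1 : has_signature G1 a1 b1 c1) (S1 : in_S (vec3 a1 b1 c1))
    (sig2 : has_signature G2 a2 b2 c2) (S2 : in_S (vec3 a2 b2 c2))
    (ha : a1 * a2 <> 1) :
  let a3 := (a1 * b2 + a1 * c2 + b1 * a2 + c1 * a2) / (1 - a1 * a2) in
  let b3 := (b1 * c2 + c1 * b2) / (1 - a1 * a2) in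
  let c3 := (b1 * b2 + c1 * c2) / (1 - a1 * a2) in
  has_signature (glue2 G1 G2) a3 b3 c3 /\ in_S (vec3 a3 b3 c3).
Proof.
move=> a3 b3 c3; split; last by apply: in_S_glue => //; exact/eqP.
have [cA cB cC] := card_VR_glue G1 G2.
case: sig1 => N1 ea1 eb1 ec1; case: sig2 => N2 ea2 eb2 ec2.
(* Among pairs of valid routes, exactly those with both types alpha are lost, which accounts for the
   denominator [1 - a1 * a2]. *)
have total : (VR_total (glue2 G1 G2) + #|VR_alpha G1| * #|VR_alpha G2| =
    VR_total G1 * VR_total G2)%N.
  by rewrite /VR_total cA cB cC; ring.
have n1 : (VR_total G1)%:R != 0 :> R by rewrite pnatr_eq0 -lt0n.
have n2 : (VR_total G2)%:R != 0 :> R by rewrite pnatr_eq0 -lt0n.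
(* If the glue had no valid routes, all pairs would have both types alpha, that is,
   [a1 * a2 = 1]. *)
have N3 : (0 < VR_total (glue2 G1 G2))%N.
  rewrite lt0n; apply/eqP => z3; apply: ha; rewrite z3 add0n in total.
  by rewrite ea1 ea2 mulf_div -!natrM total divff// natrM mulf_neq0.
have n3 : (VR_total (glue2 G1 G2))%:R != 0 :> R by rewrite pnatr_eq0 -lt0n.
have d3 : 1 - a1 * a2 =
    (VR_total (glue2 G1 G2))%:R / ((VR_total G1)%:R * (VR_total G2)%:R).
  have /(congr1 (fun n => n%:R : R)) := total.
  rewrite natrD !natrM => /(canRL (addrK _)) ->.
  by rewrite ea1 ea2; field; rewrite n1 n2.
split=> //; rewrite /a3 /b3 /c3 d3 ?cA ?cB ?cC ?ea1 ?eb1 ?ec1 ?ea2 ?eb2 ?ec2;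
  move: n1 n2 n3; move: (VR_total G1) (VR_total G2) (VR_total (glue2 G1 G2));
  by move=> v1 v2 v3 n1 n2 n3; rewrite !(natrD, natrM); field; rewrite n1 n2 n3.
Qed.
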